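(* The following decision problem \textsc{ClosureTreshold} is $\mathsf{coNP}$-complete: given a finite set $\mathcal{S}\subseteq\{0,1\}^n$ and an integer $k\ge 2$, decide whether the all-ones vector $\mathbf{1}\in\{0,1\}^n$ belongs to $Cl_{S_{10}^k}(\mathcal{S})$.
   Context: Operations $f:\{0,1\}^t\to\{0,1\}$ act on vectors of $\{0,1\}^n$ coordinate-wise. For a set of operations $\mathcal{F}$ and $\mathcal{S}\subseteq\{0,1\}^n$, $Cl_{\mathcal{F}}(\mathcal{S})$ is the smallest subset of $\{0,1\}^n$ containing $\mathcal{S}$ and closed under all operations of $\mathcal{F}$. The clone generated by a set of operations is the set of all operations obtained by composing them and the projections $\pi^n_k(x_1,\dots,x_n)=x_k$; the closure under a clone equals the closure under any generating set. The threshold operation $Th_k^{k+1}:\{0,1\}^{k+1}\to\{0,1\}$ returns $1$ iff at least $k$ of its $k+1$ arguments equal $1$. The clone $S_{10}^k$ is generated by $Th_k^{k+1}$ for $k\ge 3$, and $S_{10}^2$ is generated by the majority operation $maj(x,y,z)$ together with $x\wedge(y\vee z)$. *)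

(* Defs.v *)
From HB Require Import structures.
From mathcomp Require Import all_boot all_order all_algebra.

Set Implicit Arguments.
Unset Strict Implicit.
Unset Printing Implicit Defensive.

(** A tape is infinite in both directions.  A cell holds [Some a], or [None] for
    the blank; [left] is listed outwards from the head, and the cells outside
    [left] and [right] are blank. *)
Record tape (A : Type) := Tape {
  left : seq (option A);
  here : option A;
  right : seq (option A)
}.

Inductive move := MoveLeft | Stay | MoveRight.

Definition write_move (A : Type) (am : option A * move) (t : tape A) : tape A :=
  let: (a, m) := am in
  match m with
  | Stay => Tape (left t) a (right t)
  | MoveLeft => Tape (behead (left t)) (head None (left t)) (a :: right t)
  | MoveRight => Tape (a :: left t) (head None (right t)) (behead (right t))
  end.

Definition blank_tape (A : Type) : tape A := Tape [::] None [::].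

Definition load (A : Type) (s : seq A) : tape A :=
  if s is a :: s' then Tape [::] (Some a) (map Some s') else blank_tape A.

Fixpoint nonblank_prefix (A : Type) (s : seq (option A)) : seq A :=
  if s is Some a :: s' then a :: nonblank_prefix s' else [::].

Definition read (A : Type) (t : tape A) : seq A :=
  nonblank_prefix (here t :: right t).

(** Machines with input alphabet [I] and output alphabet [O]; the first tape is
    the input tape and the last one the output tape. *)
Record machine (I O : finType) := Machine {
  sym : finType;
  in_sym : I -> sym;
  out_sym : O -> sym;
  in_sym_inj : injective in_sym;
  out_sym_inj : injective out_sym;
  state : finType;
  start : state;
  halting : pred state;
  extra_tapes : nat;
  trans : state -> (extra_tapes.+1).-tuple (option sym) ->
          state * (extra_tapes.+1).-tuple (option sym * move)
}.

Section Run.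
Variables (I O : finType) (M : machine I O).

Record config := Config {
  cstate : state M;
  ctapes : ((extra_tapes M).+1).-tuple (tape (sym M))
}.

Definition init (x : seq I) : config :=
  Config (start M)
    [tuple if i == ord0 then load (map (@in_sym _ _ M) x) else blank_tape (sym M)
       | i < (extra_tapes M).+1].

Definition step (c : config) : config :=
  if halting (cstate c) then c else
  let: (q, w) := trans (cstate c)
                   [tuple here (tnth (ctapes c) i) | i < (extra_tapes M).+1] in
  Config q [tuple write_move (tnth w i) (tnth (ctapes c) i)
              | i < (extra_tapes M).+1].

(** On input [x], [M] halts after at most [T] steps with output [y]: halted
    configurations are fixed by [step]. *)
Definition outputs_within (T : nat) (x : seq I) (y : seq O) : Prop :=
  let c := iter T step (init x) in
  halting (cstate c) /\
  read (tnth (ctapes c) ord_max) = map (@out_sym _ _ M) y.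

End Run.

Definition language (A : finType) := seq A -> Prop.

Definition complement (A : finType) (L : language A) : language A :=
  fun x => ~ L x.

Definition poly_time (I O : finType) (f : seq I -> seq O) : Prop :=
  exists (M : machine I O) (p : {poly nat}),
    forall x, outputs_within M (p.[size x])%R x (f x).

Definition in_P (A : finType) (L : language A) : Prop :=
  exists b : seq A -> bool,
    (forall x, L x <-> b x) /\ poly_time (fun x => [:: b x]).

(** The word [x # u], for [x] over [A] and a certificate [u] over [bool]; the
    separator [#] is [None]. *)
Definition with_certificate (A : finType) (x : seq A) (u : seq bool) :
    seq (option (A + bool)) :=
  map (fun a => Some (inl a)) x ++ None :: map (fun b => Some (inr b)) u.

Definition in_NP (A : finType) (L : language A) : Prop :=
  exists (V : language (option (A + bool))) (p : {poly nat}),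
    in_P V /\
    forall x, L x <-> exists u : seq bool,
                        (size u <= (p.[size x])%R)%N /\ V (with_certificate x u).

Definition in_coNP (A : finType) (L : language A) : Prop :=
  in_NP (complement L).

Definition reducible (A B : finType) (L : language A) (L' : language B) : Prop :=
  exists f : seq A -> seq B, poly_time f /\ forall x, L x <-> L' (f x).

Definition coNP_hard (B : finType) (L : language B) : Prop :=
  forall (A : finType) (L' : language A), in_coNP L' -> reducible L' L.

Definition coNP_complete (B : finType) (L : language B) : Prop :=
  in_coNP L /\ coNP_hard L.

Definition operation (t : nat) := {ffun t.-tuple bool -> bool}.

Definition operations := forall t : nat, operation t -> Prop.

Definition projection (n : nat) (k : 'I_n) : operation n :=
  [ffun x => tnth x k].

Definition compose (t n : nat) (f : operation t) (g : 'I_t -> operation n) :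
    operation n :=
  [ffun x => f [tuple g i x | i < t]].

Inductive clone (F : operations) : operations :=
| clone_gen t (f : operation t) : F t f -> clone F f
| clone_proj n (k : 'I_n) : clone F (projection k)
| clone_comp t n (f : operation t) (g : 'I_t -> operation n) :
    clone F f -> (forall i, clone F (g i)) -> clone F (compose f g).

Definition coordinatewise (t n : nat) (f : operation t)
    (v : 'I_t -> n.-tuple bool) : n.-tuple bool :=
  [tuple f [tuple tnth (v i) j | i < t] | j < n].

Definition closed_under (F : operations) (n : nat) (A : {set n.-tuple bool}) :
    Prop :=
  forall t (f : operation t) (v : 'I_t -> n.-tuple bool),
    F t f -> (forall i, v i \in A) -> coordinatewise f v \in A.

(** Membership in the smallest closed set containing [S], as the intersection of
    all of them. *)
Definition Cl (F : operations) (n : nat) (S : {set n.-tuple bool})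
    (x : n.-tuple bool) : Prop :=
  forall A : {set n.-tuple bool}, S \subset A -> closed_under F A -> x \in A.

Definition threshold (k : nat) : operation k.+1 :=
  [ffun x : k.+1.-tuple bool => k <= count id x].

Definition ternary (f : bool -> bool -> bool -> bool) : operation 3 :=
  [ffun x => f (tnth x (inord 0)) (tnth x (inord 1)) (tnth x (inord 2))].

Definition maj : operation 3 :=
  ternary (fun x y z => [|| x && y, x && z | y && z]).

Definition and_or : operation 3 := ternary (fun x y z => x && (y || z)).

Inductive S10_generators (k : nat) : operations :=
| S10_threshold : 3 <= k -> S10_generators k (threshold k)
| S10_maj : k = 2 -> S10_generators k maj
| S10_and_or : k = 2 -> S10_generators k and_or.

Definition S10 (k : nat) : operations := clone (S10_generators k).

Definition all_ones (n : nat) : n.-tuple bool := [tuple of nseq n true].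

(** Binary expansion of [k], most significant bit first. *)
Definition binary (k : nat) : seq bool :=
  rev [seq odd (k %/ 2 ^ i) | i <- iota 0 (trunc_log 2 k).+1].

(** The word [k # 1^n # v_1 # ... # v_m] over the alphabet {0, 1, #}, with [k] in
    binary and [#] written [None].  The block [1^n] records the dimension [n],
    which cannot be read off the vectors when there are none. *)
Definition encode (n k : nat) (s : seq (n.-tuple bool)) : seq (option bool) :=
  map Some (binary k) ++
  flatten [seq None :: map Some (tval v) | v <- all_ones n :: s].

(** A set is presented by any list of its elements. *)
Definition ClosureThreshold : language (option bool) := fun w =>
  exists (n k : nat) (S : {set n.-tuple bool}) (s : seq (n.-tuple bool)),
    [/\ 2 <= k, S =i s, w = encode k s & Cl (S10 k) S (all_ones n)].

(* Main.v *)
(** The set of vectors that vanish somewhere on a set [I] of at most [k]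
    coordinates is closed under the operations of S_10^k, and conversely the
    threshold operation turns vectors equal to 1 on I \ {i_0}, ..., I \ {i_k} into
    one equal to 1 on [I].  Hence the all-ones vector is in the closure of [S] iff
    every set of at most [k] coordinates lies in the support of some vector of [S]:
    the complement of the problem asks for a set of at most [k] coordinates meeting
    the zeros of every vector, i.e. it is the hitting set problem.

    A hitting set is a certificate that is checked in polynomial time.  For hardness,
    the tableau of a verifier run has one cell for each time and depth, with a
    content from a fixed finite alphabet; choosing the content of every cell is
    choosing one element from each of disjoint blocks, which is forced by setting [k]
    to the number of cells, and the local rules of the tableau are disjunctions of
    conditions "the content of this cell lies in that set", i.e. sets to be hit.

    Polynomial time on multitape machines is obtained from a class of string
    functions that is closed under composition, case analysis and a fold over the
    positions of a string whose body sees the part already read and the part to come. *)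

Require Import Defs.
From HB Require Import structures.
From mathcomp Require Import all_boot all_order all_algebra.
From mathcomp Require Import zify.
From Stdlib Require Import Classical.

Set Implicit Arguments.
Unset Strict Implicit.
Unset Printing Implicit Defensive.

(** Both halves of the completeness proof need actual machines, so the constructions are shaped by
    what a fold over strings can compute. No arithmetic on positions is available: a tableau cell is
    addressed by copying the labels of all rows and columns with marks at the current place and its
    neighbours, and a column label must reveal by itself whether it is the first. The heads stay at
    column 0 and the tapes shift instead, so that a window consists of the control cell and adjacent
    depths whatever the number of tapes. The length of the certificate is only bounded, so its cells
    are guessed and an extra clause lets a blank be followed by blanks only. All strings are coded
    in one alphabet ['I_N.+1], which makes composition free of recoding; the large alphabet of cell
    contents never occurs on a tape of the reduction. *)

Ltac cardle := rewrite ?card_option ?card_sum ?card_option ?card_bool ?card_unit; lia.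

(** * Polynomial bounds *)

Definition peval (p : {poly nat}) (n : nat) : nat := (p.[n])%R.

Lemma pevalD p q n : peval (p + q)%R n = peval p n + peval q n.
Proof. by rewrite /peval hornerD. Qed.

Lemma pevalM p q n : peval (p * q)%R n = peval p n * peval q n.
Proof. by rewrite /peval hornerM. Qed.

Lemma pevalX n : peval 'X%R n = n.
Proof. by rewrite /peval hornerX. Qed.

Lemma pevalC c n : peval (c%:P)%R n = c.
Proof. by rewrite /peval hornerC. Qed.

Lemma peval_comp p q n : peval (p \Po q)%R n = peval p (peval q n).
Proof. by rewrite /peval horner_comp. Qed.

Definition pevalE := (pevalD, pevalM, pevalX, pevalC, peval_comp).

(** Natural coefficients leave no room for cancellation; monotonicity is what allows size bounds to
    be substituted into time bounds. *)
Lemma peval_mono p m n : m <= n -> peval p m <= peval p n.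
Proof.
move=> lemn; elim/poly_ind: p => [|p c IH]; first by rewrite /peval !horner0.
by rewrite !pevalE leq_add2r leq_mul.
Qed.

Lemma peval_sum (I : finType) (F : I -> {poly nat}) i n :
  peval (F i) n <= peval (\sum_j F j)%R n.
Proof. by rewrite (bigD1 i) //= pevalD leq_addr. Qed.

(** * Stack machines *)

(** Every state of a component inspects a single register (a tape), so that the
    number of tapes can be read off the component once it is complete; the
    target [None] is the exit. *)
Record component (A : Type) := Component {
  cstates : finType;
  cinit : cstates;
  creg : cstates -> nat;
  ctrans : cstates -> option A -> (option A * move) * option cstates
}.

Definition upd (T : Type) (st : nat -> T) i v : nat -> T :=
  fun j => if j == i then v else st j.

Lemma updE (T : Type) (st : nat -> T) i v j : upd st i v j = if j == i then v else st j.
Proof. by []. Qed.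

Ltac updc := rewrite ?updE;
  repeat (match goal with |- context [?x == ?y :> nat] => case: (@eqP _ x y) => ? end);
  subst; rewrite ?cats0 //; try lia.
Ltac upds := let j := fresh "j" in move=> j; updc.

Section Components.
Variable A : finType.
Implicit Types (c : component A) (ts : nat -> tape A) (st : nat -> seq A).

(** Register files are functions, so they are related by pointwise equality, which avoids functional
    extensionality. *)
Inductive runs c : cstates c -> (nat -> tape A) -> nat -> (nat -> tape A) -> Prop :=
| runs_exit q ts ts' am :
    ctrans q (here (ts (creg q))) = (am, None) ->
    ts' =1 upd ts (creg q) (write_move am (ts (creg q))) ->
    runs q ts 1 ts'
| runs_step q q' ts ts' n am ts1 :
    ctrans q (here (ts (creg q))) = (am, Some q') ->
    ts1 =1 upd ts (creg q) (write_move am (ts (creg q))) ->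
    runs q' ts1 n ts' -> runs q ts n.+1 ts'.

(** A register is a stack whose top is under the head. Nothing is required to the left of the head,
    since a push overwrites the cell that it moves onto; [m] absorbs blanks left by earlier
    moves. *)
Definition holds (t : tape A) (s : seq A) :=
  exists m, here t :: right t = map Some s ++ nseq m None.

Definition holds_all ts st := forall i, holds (ts i) (st i).

Definition computes c st T st' := forall ts, holds_all ts st ->
  exists n ts', [/\ n <= T, runs (cinit c) ts n ts' & holds_all ts' st'].

Lemma computes_ext c st1 st2 T1 T2 st1' st2' :
  st1 =1 st1' -> st2 =1 st2' -> T1 <= T2 ->
  computes c st1 T1 st2 -> computes c st1' T2 st2'.
Proof.
move=> e1 e2 leT H ts hts; case: (H ts) => [i|n [ts' [len r h]]].
  by rewrite e1.
exists n, ts'; split=> [||i]; [exact: leq_trans leT|by []|by rewrite -e2].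
Qed.

Lemma holds_here t s : holds t s -> here t = ohead s.
Proof. by case=> m; case: s => [|a s] /=; [case: m => //= m|] => -[]. Qed.

Lemma holds_read t s : holds t s -> read t = s.
Proof.
case=> m e; rewrite /read e; elim: s {e} => [|a s IH] /=; last by rewrite IH.
by case: m.
Qed.

Lemma holds_load (s : seq A) : holds (load s) s.
Proof. by case: s => [|a s]; [exists 1|exists 0; rewrite cats0]. Qed.

Lemma holds_blank : holds (blank_tape A) [::].
Proof. by exists 1. Qed.

Lemma holds_pop t a s : holds t (a :: s) -> holds (write_move (None, MoveRight) t) s.
Proof.
case=> m /= [_ e]; rewrite /holds /= e.
case: s {e} => [|b s] /=; last by exists m.
by case: m => [|m]; [exists 1|exists m.+1].
Qed.

Lemma holds_stay t s : holds t s -> holds (write_move (here t, Stay) t) s.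
Proof. by case: t. Qed.

Lemma holds_push t a s : holds t s ->
  holds (write_move (Some a, Stay) (write_move (here t, MoveLeft) t)) (a :: s).
Proof. by case=> m e; exists m => /=; rewrite e. Qed.

Definition skip : component A :=
  Component (cstates := unit) tt (fun _ => 0) (fun _ o => ((o, Stay), None)).

Lemma skip_computes st : computes skip st 1 st.
Proof.
move=> ts h; exists 1, (upd ts 0 (write_move (here (ts 0), Stay) (ts 0))).
split=> //; first exact: runs_exit.
by move=> i; rewrite /upd; case: eqP => [->|_]; [exact: holds_stay|exact: h].
Qed.
Arguments skip_computes : clear implicits.

Definition push i a : component A :=
  Component (cstates := bool) false (fun _ => i)
    (fun q o => if q then ((Some a, Stay), None) else ((o, MoveLeft), Some true)).

Lemma push_computes st i a : computes (push i a) st 2 (upd st i (a :: st i)).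
Proof.
move=> ts h.
pose t := write_move (Some a, Stay) (write_move (here (ts i), MoveLeft) (ts i)).
exists 2, (upd ts i t); split=> //.
  apply: (@runs_step (push i a) false true _ _ _ _ _ erefl (fun _ => erefl)).
  apply: runs_exit => //= j; rewrite /upd; case: eqP => // _.
  by rewrite eqxx.
by move=> j; rewrite /upd; case: eqP => // _; apply: holds_push.
Qed.
Arguments push_computes : clear implicits.

Definition popc i : component A :=
  Component (cstates := unit) tt (fun _ => i)
    (fun _ o => if o is Some a then ((None, MoveRight), None) else ((None, Stay), None)).

Lemma popc_computes st i : computes (popc i) st 1 (upd st i (behead (st i))).
Proof.
move=> ts h; have e := holds_here (h i).
pose am : option A * move := (None, if st i is [::] then Stay else MoveRight).
exists 1, (upd ts i (write_move am (ts i))); split=> //.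
  apply: (@runs_exit (popc i) tt ts _ am) => //=; rewrite e /am.
  by case: (st i).
move=> j; rewrite /upd; case: eqP => // _; rewrite /am.
case E: (st i) (h i) e => [|a s] hi /= e; last exact: holds_pop hi.
by rewrite -e; apply: holds_stay.
Qed.
Arguments popc_computes : clear implicits.

Definition seqc c1 c2 : component A :=
  Component (cstates := (cstates c1 + cstates c2)%type) (inl (cinit c1))
    (fun q => match q with inl q => creg q | inr q => creg q end)
    (fun q o => match q with
     | inl q => let: (am, q') := ctrans q o in
        (am, Some (if q' is Some q1 then inl q1 else inr (cinit c2)))
     | inr q => let: (am, q') := ctrans q o in (am, omap inr q')
     end).

Lemma runs_seqr c1 c2 q ts n ts' :
  runs q ts n ts' -> runs (c := seqc c1 c2) (inr q) ts n ts'.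
Proof.
elim=> {q ts n ts'} [q ts ts' am e u|q q' ts ts' n am ts1 e u _ IH].
  by apply: (@runs_exit (seqc c1 c2) (inr q) _ _ am) => //=; rewrite e.
by apply: (@runs_step (seqc c1 c2) (inr q) (inr q') _ _ _ am ts1) => //=; rewrite e.
Qed.

Lemma runs_seql c1 c2 q ts n ts1 m ts2 :
  runs q ts n ts1 -> runs (cinit c2) ts1 m ts2 ->
  runs (c := seqc c1 c2) (inl q) ts (n + m) ts2.
Proof.
move=> H1 H2; elim: H1 H2 => {q ts n ts1} [q ts ts' am e u|q q' ts ts' n am ts1 e u _ IH] H2.
  apply: (@runs_step (seqc c1 c2) (inl q) (inr (cinit c2)) ts ts2 m am ts') => //=.
    by rewrite e.
  exact: runs_seqr.
apply: (@runs_step (seqc c1 c2) (inl q) (inl q') ts ts2 (n + m) am ts1) => //=.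
  by rewrite e.
exact: IH.
Qed.

Lemma seqc_computes c1 c2 st1 T1 st2 T2 st3 :
  computes c1 st1 T1 st2 -> computes c2 st2 T2 st3 ->
  computes (seqc c1 c2) st1 (T1 + T2) st3.
Proof.
move=> H1 H2 ts /H1[n [ts1 [len r1 /H2[m [ts2 [lem r2 h2]]]]]].
by exists (n + m), ts2; split=> //; [exact: leq_add|exact: runs_seql r2].
Qed.

Definition casec i (c : option A -> component A) : component A :=
  Component (cstates := option {o : option A & cstates (c o)}) None
    (fun q => if q is Some q then creg (tagged q) else i)
    (fun q o => if q is Some q then
        let: (am, q') := ctrans (tagged q) o in
        (am, omap (fun r => Some (Tagged (fun o => cstates (c o)) r)) q')
      else ((o, Stay), Some (Some (Tagged (fun o => cstates (c o)) (cinit (c o)))))).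

Lemma runs_case i (c : option A -> component A) o q ts n ts' :
  runs (c := c o) q ts n ts' ->
  runs (c := casec i c) (Some (Tagged (fun o => cstates (c o)) q)) ts n ts'.
Proof.
elim=> {q ts n ts'} [q ts ts' am e u|q q' ts ts' n am ts1 e u _ IH].
  by apply: (@runs_exit (casec i c) (Some (Tagged (fun o => cstates (c o)) q)) _ _ am) => //=;
    rewrite e.
by apply: (@runs_step (casec i c) (Some (Tagged (fun o => cstates (c o)) q)) (Some (Tagged (fun o
  => cstates (c o)) q')) _ _ _ am ts1)
  => //=; rewrite e.
Qed.

Lemma casec_computes i (c : option A -> component A) st T st' :
  computes (c (ohead (st i))) st T st' -> computes (casec i c) st T.+1 st'.
Proof.
move=> H ts h; have e := holds_here (h i).
pose ts0 := upd ts i (write_move (here (ts i), Stay) (ts i)).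
have h0 : holds_all ts0 st.
  by move=> j; rewrite /ts0 /upd; case: eqP => [->|_]; [exact: holds_stay|exact: h].
have [n [ts' [len r h']]] := H ts0 h0.
exists n.+1, ts'; split=> //.
apply: (@runs_step (casec i c) None
  (Some (Tagged (fun o => cstates (c o)) (cinit (c (ohead (st i))))))
  ts ts' n (here (ts i), Stay) ts0) => //=; last exact: runs_case.
by rewrite e.
Qed.

(** Pops the symbols of register [i] one by one; [c a] is run after [a] has been
    popped. *)
Definition whilec i (c : A -> component A) : component A :=
  Component (cstates := option {a : A & cstates (c a)}) None
    (fun q => if q is Some q then creg (tagged q) else i)
    (fun q o => if q is Some q then
        let: (am, q') := ctrans (tagged q) o in
        (am, Some (omap (Tagged (fun a => cstates (c a))) q'))
      else if o is Some a then
        ((None, MoveRight), Some (Some (Tagged (fun a => cstates (c a)) (cinit (c a)))))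
      else ((None, Stay), None)).

Lemma runs_while i (c : A -> component A) a q ts n ts1 m ts2 :
  runs (c := c a) q ts n ts1 -> runs (c := whilec i c) None ts1 m ts2 ->
  runs (c := whilec i c) (Some (Tagged (fun a => cstates (c a)) q)) ts (n + m) ts2.
Proof.
move=> H1 H2; elim: H1 H2 => {q ts n ts1} [q ts ts' am e u|q q' ts ts' n am ts1 e u _ IH] H2.
  apply: (@runs_step (whilec i c) (Some (Tagged (fun a => cstates (c a)) q)) None
     ts ts2 m am ts') => //=.
  by rewrite e.
apply: (@runs_step (whilec i c) (Some (Tagged (fun a => cstates (c a)) q))
  (Some (Tagged (fun a => cstates (c a)) q')) ts ts2 (n + m) am ts1) => //=.
  by rewrite e.
exact: IH.
Qed.

(** [F d r] is the loop invariant: the registers once the letters of [d], stored in reverse, have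
    been popped and [r] is left. The body starts after the pop of [a], which is why register [i] is
    overridden by the image of [r]. *)
Lemma whilec_computes_map (L : Type) (cd : L -> A) i (c : A -> component A) T s
    (F : seq L -> seq L -> nat -> seq A) :
  (forall d r, F d r i = map cd r) ->
  (forall d a r, catrev d (a :: r) = s ->
     computes (c (cd a)) (upd (F d (a :: r)) i (map cd r)) T (F (a :: d) r)) ->
  computes (whilec i c) (F [::] s) ((size s).+1 * T.+1) (F (rev s) [::]).
Proof.
move=> Fi Hc.
suff H d r : catrev d r = s ->
    computes (whilec i c) (F d r) ((size r).+1 * T.+1) (F (catrev r d) [::]).
  by rewrite -[rev s]/(catrev s [::]); apply: H.
elim: r d => [|a r IH] d es ts h.
  have e := holds_here (h i); rewrite Fi /= in e.
  exists 1, (upd ts i (write_move (None, Stay) (ts i))); split=> //.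
    by apply: (@runs_exit (whilec i c) None ts _ (None, Stay)) => //=; rewrite e.
  move=> j; rewrite /upd; case: eqP => [->|_]; last exact: h.
  by rewrite -e; apply: holds_stay; apply: h.
have e := holds_here (h i); rewrite Fi /= in e.
pose ts0 := upd ts i (write_move (None, MoveRight) (ts i)).
have h0 : holds_all ts0 (upd (F d (a :: r)) i (map cd r)).
  move=> j; rewrite /ts0 /upd; case: eqP => [_|_]; last exact: h.
  by apply: (@holds_pop _ (cd a)); have := h i; rewrite Fi.
have [n [ts1 [len r1 h1]]] := Hc _ _ _ es ts0 h0.
have [m [ts2 [lem r2 h2]]] := IH (a :: d) es ts1 h1.
exists (n + m).+1, ts2; split=> //=.
  by rewrite mulSn -addSn leq_add.
apply: (@runs_step (whilec i c) None
  (Some (Tagged (fun a => cstates (c a)) (cinit (c (cd a))))) ts ts2 (n + m)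
  (None, MoveRight) ts0) => //=; last exact: runs_while r2.
by rewrite e.
Qed.

Lemma whilec_computes i (c : A -> component A) T s (F : seq A -> seq A -> nat -> seq A) :
  (forall d r, F d r i = r) ->
  (forall d a r, catrev d (a :: r) = s ->
     computes (c a) (upd (F d (a :: r)) i r) T (F (a :: d) r)) ->
  computes (whilec i c) (F [::] s) ((size s).+1 * T.+1) (F (rev s) [::]).
Proof.
move=> Fi Hc; apply: (@whilec_computes_map A id) => [d r|d a r es].
  by rewrite map_id.
by rewrite map_id; apply: Hc.
Qed.

Definition pourc i j : component A := whilec i (fun a => push j a).

Lemma pourc_computes st i j : i <> j ->
  computes (pourc i j) st ((size (st i)).+1 * 3) (upd (upd st i [::]) j (catrev (st i) (st j))).
Proof.
move=> ij.
pose F d r := upd (upd st i r) j (d ++ st j).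
apply: (@computes_ext _ (F [::] (st i)) (F (rev (st i)) [::])); last first.
- apply: whilec_computes => [d r|d a r _]; first by rewrite /F; updc.
  apply: (computes_ext (fun _ => erefl) _ (leqnn 2) (push_computes _ _ _)).
  by rewrite /F; upds.
- by [].
- by rewrite /F catrevE; upds.
- by rewrite /F; upds.
Qed.
Arguments pourc_computes : clear implicits.

Definition clearc i : component A := whilec i (fun _ => skip).

Lemma clearc_computes st i :
  computes (clearc i) st ((size (st i)).+1 * 2) (upd st i [::]).
Proof.
pose F (d r : seq A) := upd st i r.
apply: (@computes_ext _ (F [::] (st i)) (F (rev (st i)) [::])); last first.
- apply: whilec_computes => [d r|d a r _]; first by rewrite /F; updc.
  apply: (computes_ext (fun _ => erefl) _ (leqnn 1) (skip_computes _)).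
  by rewrite /F; upds.
- by [].
- by [].
- by rewrite /F; upds.
Qed.
Arguments clearc_computes : clear implicits.

(** Pouring reverses a stack, so a move pours twice, through the scratch register [k]. *)
Definition movec j i k : component A := seqc (clearc i) (seqc (pourc j k) (pourc k i)).

Lemma movec_computes st i j k : i <> j -> j <> k -> i <> k -> st k = [::] ->
  computes (movec j i k) st (((size (st i)).+1 + (size (st j)).+1) * 6)
    (upd (upd st j [::]) i (st j)).
Proof.
move=> ij jk ik k0.
apply: (computes_ext (fun _ => erefl) _ _
  (seqc_computes (clearc_computes st i)
  (seqc_computes (pourc_computes _ _ _ jk) (pourc_computes _ _ _ (nesym ik))))).
  by upds; rewrite ?k0 !catrevE ?cats0 ?revK.
by updc; rewrite ?k0 !catrevE ?cats0 ?size_rev /=; lia.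
Qed.
Arguments movec_computes : clear implicits.

Definition copyc i j k : component A :=
  seqc (pourc i k) (whilec k (fun a => seqc (push i a) (push j a))).

Lemma copyc_computes st i j k : i <> j -> j <> k -> i <> k -> st j = [::] -> st k = [::] ->
  computes (copyc i j k) st ((size (st i)).+1 * 8) (upd st j (st i)).
Proof.
move=> ij jk ik j0 k0.
pose F d r := upd (upd (upd st k r) i d) j d.
have H : computes (whilec k (fun a => seqc (push i a) (push j a)))
    (F [::] (rev (st i))) ((size (rev (st i))).+1 * 5) (F (rev (rev (st i))) [::]).
  apply: whilec_computes => [d r|d a r _]; first by rewrite /F; updc.
  apply: (computes_ext (fun _ => erefl) _ (leqnn 4) (seqc_computes (push_computes _ _ _)
    (push_computes _ _ _))).
  by rewrite /F; upds.
apply: (@computes_ext _ st (F (rev (rev (st i))) [::])); last first.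
- apply: seqc_computes (pourc_computes _ _ _ ik) _.
  apply: (computes_ext _ (fun _ => erefl) (leqnn _) H).
  by rewrite /F catrevE k0 cats0; upds.
- by rewrite size_rev; lia.
- by rewrite /F revK; upds.
- by [].
Qed.
Arguments copyc_computes : clear implicits.

End Components.

Arguments skip_computes {A} st.
Arguments skip {A}.
Arguments popc {A}.
Arguments pourc {A}.
Arguments clearc {A}.
Arguments movec {A}.
Arguments copyc {A}.
Arguments push_computes {A} st i a.
Arguments popc_computes {A} st i.
Arguments pourc_computes {A} st i j.
Arguments clearc_computes {A} st i.
Arguments movec_computes {A} st i j k.
Arguments copyc_computes {A} st i j k.

(** * From components to machines *)

Section ToMachine.
Variables (A I O : finType) (inA : I -> A) (outA : O -> A).
Hypotheses (inA_inj : injective inA) (outA_inj : injective outA).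
Variables (c : component A) (K : nat).
Hypothesis creg_le : forall q : cstates c, creg q <= K.

(** The exit becomes the only halting state. A machine step acts on all tapes at once, so the tapes
    that are not inspected rewrite their own symbol and stay. *)
Definition machine_of : machine I O :=
  @Machine I O A inA outA inA_inj outA_inj (option (cstates c)) (Some (cinit c))
    (fun q => ~~ isSome q) K
    (fun q hs => if q is Some q then
         let: (am, q') := ctrans q (tnth hs (inord (creg q))) in
         (q', [tuple if i == creg q :> nat then am else (tnth hs i, Stay) | i < K.+1])
       else (None, [tuple (tnth hs i, Stay) | i < K.+1])).

Lemma write_here (t : tape A) : write_move (here t, Stay) t = t.
Proof. by case: t. Qed.

Lemma machine_of_step q am q' (ts ts1 : nat -> tape A) :
  ctrans q (here (ts (creg q))) = (am, q') ->
  ts1 =1 upd ts (creg q) (write_move am (ts (creg q))) ->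
  step (Config (M := machine_of) (Some q) [tuple ts i | i < K.+1])
    = Config (M := machine_of) q' [tuple ts1 i | i < K.+1].
Proof.
move=> e u; rewrite /step /= !tnth_mktuple inordK ?ltnS ?creg_le // e.
congr Config; apply: eq_from_tnth => i; rewrite !tnth_mktuple u /upd.
by case: eqP => [->//|_]; rewrite write_here.
Qed.

Lemma machine_of_runs q ts n ts' : runs q ts n ts' ->
  exists ts'', ts'' =1 ts' /\
  iter n (@step _ _ machine_of) (Config (M := machine_of) (Some q) [tuple ts i | i < K.+1])
    = Config (M := machine_of) None [tuple ts'' i | i < K.+1].
Proof.
elim=> {q ts n ts'} [q ts ts' am e u|q q' ts ts' n am ts1 e u _ [ts'' [e' IH]]].
  by exists ts'; split=> //; apply: machine_of_step e u.
by exists ts''; split=> //; rewrite iterSr (machine_of_step e u).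
Qed.

Lemma machine_of_outputs T (x : seq I) (y : seq O) st' :
  computes c (upd (fun _ => [::]) 0 (map inA x)) T st' -> st' K = map outA y ->
  outputs_within machine_of T x y.
Proof.
move=> H eK.
pose ts := upd (fun _ => blank_tape A) 0 (load (map inA x)).
have h : holds_all ts (upd (fun _ => [::]) 0 (map inA x)).
  by move=> i; rewrite /ts /upd; case: eqP => _; [exact: holds_load|exact: holds_blank].
have [n [ts' [len r h']]] := H ts h.
have [ts'' [e it]] := machine_of_runs r.
rewrite /outputs_within -(subnK len) iterD.
have -> : init machine_of x = Config (M := machine_of) (Some (cinit c)) [tuple ts i | i < K.+1].
  by congr Config; apply: eq_from_tnth => i; rewrite !tnth_mktuple.
(* The time bound may exceed the exact running time; the halted configuration absorbs the remaining
   steps. *)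
rewrite it; have -> m : iter m (@step _ _ machine_of) (Config (M := machine_of) None [tuple ts''
  i | i < K.+1])
  = Config (M := machine_of) None [tuple ts'' i | i < K.+1].
  by elim: m => //= m ->.
split=> //=; rewrite tnth_mktuple /= e -eK.
exact: holds_read.
Qed.

End ToMachine.

(** * Polynomial-time string functions *)

Section FP.
Variable N : nat.
Notation str := (seq 'I_N.+1).

Definition code (L : finType) (a : L) : 'I_N.+1 := inord (enum_rank a).

Lemma code_inj (L : finType) : #|L| <= N.+1 -> injective (@code L).
Proof.
move=> leL a b /(congr1 val); rewrite /= !inordK ?(leq_trans (ltn_ord _) leL) //.
by move=> /val_inj /enum_rank_inj.
Qed.

Definition enc (L : finType) (s : seq L) : str := map (@code L) s.

Lemma size_enc (L : finType) (s : seq L) : size (enc s) = size s.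
Proof. exact: size_map. Qed.

Definition psize (X : Type) (ps : seq (X -> str)) (x : X) :=
  sumn [seq size (p x) | p <- ps].

Definition stores (X : Type) (ps : seq (X -> str)) (rho : seq nat) k x st :=
  (forall i, i < size ps -> st (nth 0 rho i) = nth (fun=> [::]) ps i x) /\
  (forall j, k <= j -> st j = [::]).

(** [f x] is computed in polynomial time from the strings [p x], [p] in [ps]: for
    any registers [rho] below [k] holding these strings, some component puts
    [f x] into register [k] and restores all other registers, provided that the
    registers from [k] on are empty initially. *)
Definition FP (X : Type) (ps : seq (X -> str)) (f : X -> str) :=
  (exists q, forall x, size (f x) <= peval q (psize ps x)) /\
  forall rho k, size rho = size ps -> all (ltn^~ k) rho ->
  exists cp : component 'I_N.+1 * {poly nat}, forall x st, stores ps rho k x st ->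
    computes cp.1 st (peval cp.2 (psize ps x)) (upd st k (f x)).

(** Context extension: as with de Bruijn indices, the newly bound strings come first. *)
Definition extend (X Z : Type) (qs : seq (Z -> str)) (ps : seq (X -> str)) :
    seq (X * Z -> str) :=
  [seq (fun y => q y.2) | q <- qs] ++ [seq (fun y => p y.1) | p <- ps].

Lemma psize_extend (X Z : Type) (qs : seq (Z -> str)) (ps : seq (X -> str)) x z :
  psize (extend qs ps) (x, z) = psize qs z + psize ps x.
Proof. by rewrite /psize /extend map_cat sumn_cat -!map_comp. Qed.

Lemma size_extend (X Z : Type) (qs : seq (Z -> str)) (ps : seq (X -> str)) :
  size (extend qs ps) = size qs + size ps.
Proof. by rewrite size_cat !size_map. Qed.

Lemma nth_psize (X : Type) (ps : seq (X -> str)) i x :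
  size (nth (fun=> [::]) ps i x) <= psize ps x.
Proof.
rewrite /psize; elim: ps i => [|p ps IH] [|i] //=; first exact: leq_addr.
exact: leq_trans (IH i) (leq_addl _ _).
Qed.

Lemma psize_le (X : Type) (ps : seq (X -> str)) m x :
  (forall i, i < size ps -> size (nth (fun=> [::]) ps i x) <= m) ->
  psize ps x <= size ps * m.
Proof.
rewrite /psize; elim: ps => [|p ps IH] //= h; rewrite mulSn leq_add //.
  exact: (h 0).
by apply: IH => i hi; apply: (h i.+1).
Qed.

Lemma stores_upd (X : Type) (ps : seq (X -> str)) rho k x st v :
  size rho = size ps -> all (ltn^~ k) rho -> stores ps rho k x st ->
  stores ps rho k.+1 x (upd st k v).
Proof.
move=> sz /allP lt [h1 h2]; split=> [i lti|j lej]; rewrite updE.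
  have := lt (nth 0 rho i); rewrite mem_nth ?sz // => /(_ isT) /= ltk.
  by rewrite ltn_eqF // h1.
by rewrite gtn_eqF // h2 // ltnW.
Qed.

Lemma all_ltnW rho m n : m <= n -> all (ltn^~ m) rho -> all (ltn^~ n) rho.
Proof. by move=> le; apply: sub_all => i /= /leq_trans; apply. Qed.

Lemma FP_ext (X : Type) (ps : seq (X -> str)) f g : f =1 g -> FP ps f -> FP ps g.
Proof.
move=> e [[q hq] H]; split; first by exists q => x; rewrite -e.
move=> rho k sz lt; have [cp h] := H rho k sz lt; exists cp => x st /h.
by apply: computes_ext => // j; rewrite !updE e.
Qed.

(** A change of context: [idx] sends each string of [qs] to the string of [ps] that it equals. One
    string may serve several times, hence the factor [size qs] in the bounds. *)
Lemma FP_sub (X Y : Type) (ps : seq (X -> str)) (qs : seq (Y -> str)) (phi : X -> Y)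
    (idx : seq nat) F :
  size idx = size qs ->
  (forall i, i < size qs -> nth 0 idx i < size ps) ->
  (forall i x, i < size qs ->
     nth (fun=> [::]) qs i (phi x) = nth (fun=> [::]) ps (nth 0 idx i) x) ->
  FP qs F -> FP ps (fun x => F (phi x)).
Proof.
move=> szi lti ei [[q hq] H].
have le x : psize qs (phi x) <= size qs * psize ps x.
  by apply: psize_le => i hi; rewrite ei //; apply: nth_psize.
have lep p x : peval p (psize qs (phi x)) <= peval (p \Po ((size qs)%:P * 'X))%R (psize ps x).
  by rewrite !pevalE; apply: peval_mono.
split; first by exists (q \Po ((size qs)%:P * 'X))%R => x; apply: leq_trans (lep _ _).
move=> rho k sz lt; have [||[c p] h] := H (map (nth 0 rho) idx) k; first by rewrite size_map.
  apply/allP=> y /mapP[i /(nthP 0)[j]]; rewrite szi => hj <- ->.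
  by apply: (allP lt); rewrite mem_nth // sz lti.
exists (c, p \Po ((size qs)%:P * 'X))%R => x st [h1 h2].
apply: (computes_ext (fun _ => erefl) (fun _ => erefl) (lep _ _) (h (phi x) st _)).
split=> // i hi; rewrite (nth_map 0) ?szi // h1 ?lti //.
by rewrite ei.
Qed.

Lemma FP_weak (X Z : Type) (ps : seq (X -> str)) (qs : seq (Z -> str)) f :
  FP ps f -> FP (extend qs ps) (fun y => f y.1).
Proof.
apply: (@FP_sub _ _ _ _ (@fst X Z) (iota (size qs) (size ps))) => [|i hi|i x hi].
- by rewrite size_iota.
- by rewrite nth_iota // size_extend ltn_add2l.
- rewrite nth_iota // nth_cat size_map ltnNge leq_addr /= addKn.
  by rewrite (nth_map (fun=> [::])).
Qed.

Lemma FP_var (X : Type) (ps : seq (X -> str)) i : i < size ps ->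
  FP ps (nth (fun=> [::]) ps i).
Proof.
move=> lti; split; first by exists 'X%R => x; rewrite pevalX; apply: nth_psize.
move=> rho k sz lt; exists (copyc (nth 0 rho i) k k.+1, (('X + 1%N%:P) * 8%N%:P)%R) => x st [h1
  h2] /=.
have ltk : nth 0 rho i < k by apply: (allP lt); rewrite mem_nth // sz.
apply: (computes_ext (fun _ => erefl) _ _ (copyc_computes st (nth 0 rho i) k k.+1 _ _ _ _ _)).
- by move=> j; rewrite !updE h1.
- by rewrite h1 // !pevalE addn1 leq_mul // ltnS nth_psize.
- by move=> e; rewrite e ltnn in ltk.
- by move/eqP; rewrite -[X in X == _]addn0 -addn1 eqn_add2l.
- by move=> e; move: ltk; rewrite e; lia.
- by rewrite h2.
- by rewrite h2.
Qed.

Lemma FP_nil (X : Type) (ps : seq (X -> str)) : FP ps (fun=> [::]).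
Proof.
split; first by exists 0%R => x.
move=> rho k sz lt; exists (skip, (1%N%:P)%R) => x st [h1 h2] /=.
apply: (computes_ext (fun _ => erefl) _ _ (skip_computes _)); last by rewrite pevalC.
by move=> j; rewrite updE; case: eqP => // ->; rewrite h2.
Qed.

Lemma FP_push (X : Type) (ps : seq (X -> str)) a f :
  FP ps f -> FP ps (fun x => a :: f x).
Proof.
move=> [[q hq] H]; split; first by exists (q + 1%N%:P)%R => x; rewrite !pevalE addn1 ltnS.
move=> rho k sz lt; have [[c p] h] := H rho k sz lt.
exists (seqc c (push k a), (p + 2%N%:P)%R) => x st /h /= hc.
apply: (computes_ext (fun _ => erefl) _ _ (seqc_computes hc (push_computes _ _ _))).
  by upds.
by rewrite !pevalE.
Qed.

Lemma FP_behead (X : Type) (ps : seq (X -> str)) f :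
  FP ps f -> FP ps (fun x => behead (f x)).
Proof.
move=> [[q hq] H]; split.
  by exists q => x; rewrite size_behead; apply: leq_trans (leq_pred _) (hq x).
move=> rho k sz lt; have [[c p] h] := H rho k sz lt.
exists (seqc c (popc k), (p + 1%N%:P)%R) => x st /h /= hc.
apply: (computes_ext (fun _ => erefl) _ _ (seqc_computes hc (popc_computes _ _))).
  by upds.
by rewrite !pevalE.
Qed.

Lemma FP_case_raw (X : Type) (ps : seq (X -> str)) f g :
  FP ps f -> (forall o, FP ps (g o)) -> FP ps (fun x => g (ohead (f x)) x).
Proof.
move=> [[q hq] H] Hg.
have [qg hqg] := fin_all_exists (fun o => proj1 (Hg o)).
split.
  exists (\sum_o qg o)%R => x; apply: leq_trans (hqg _ x) _.
  exact: peval_sum.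
move=> rho k sz lt; have [[c p] h] := H rho k sz lt.
have [cp hcp] := fin_all_exists (fun o => proj2 (Hg o) rho k sz lt).
(* The scrutinee is left in register [k], which the branches expect to be empty, so each branch
   clears it first. *)
exists (seqc c (casec k (fun o => seqc (clearc k) (cp o).1)),
  (p + ((q + 1%N%:P) * 2%N%:P + \sum_o (cp o).2 + 1%N%:P))%R) => x st hst /=.
have hc := h _ _ hst; rewrite /= in hc.
apply: (computes_ext (fun _ => erefl) (fun _ => erefl) _ (seqc_computes hc (casec_computes _))).
  rewrite 2!pevalD leq_add2l pevalC addn1; exact: leqnn.
rewrite updE eqxx.
apply: (computes_ext (fun _ => erefl) (fun _ => erefl) _ (seqc_computes (clearc_computes _ _)
  _)); last first.
  apply: (computes_ext _ (fun _ => erefl) _ (hcp _ _ _ hst)); last exact: leqnn.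
  by move=> j; rewrite !updE; case: eqP => // ->; rewrite (proj2 hst).
rewrite updE eqxx pevalD leq_add //; last exact: (peval_sum (fun o => (cp o).2)).
by rewrite !pevalE leq_mul // addn1 ltnS.
Qed.

(** * Folds with access to both contexts *)

Fixpoint zfold (L Z : Type) (h : L -> Z -> seq L -> seq L -> Z) z d r :=
  if r is a :: r' then zfold h (h a z d r') (a :: d) r' else z.

(** The accumulator of [zfold] at the moment when [d] (reversed) has been read
    and [r] is left. *)
Fixpoint zstate (L Z : Type) (h : L -> Z -> seq L -> seq L -> Z) z d r :=
  if d is a :: d' then h a (zstate h z d' (a :: r)) d' r else z.

Lemma zstate_zfold (L Z : Type) (h : L -> Z -> seq L -> seq L -> Z) z d r :
  zstate h z (catrev r d) [::] = zfold h (zstate h z d r) d r.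
Proof. by elim: r d => [|a r IH] d //=; rewrite IH. Qed.

(** Iterating a polynomial-time body can produce exponentially long accumulators. The last premise
    excludes this: one step adds a length bounded in terms of the parameters and the string folded
    over, not of the accumulator. *)
Lemma FP_zfold (X Z : Type) (ps : seq (X -> str)) (ez : Z -> str) (L : finType)
    (f : X -> seq L) (g : X -> Z) (h : L -> X -> Z -> seq L -> seq L -> Z) :
  #|L| <= N.+1 ->
  FP ps (fun x => enc (f x)) -> FP ps (fun x => ez (g x)) ->
  (forall a, FP (extend [:: (fun z => ez z.1); (fun z => enc z.2.1); (fun z => enc z.2.2)] ps)
     (fun y : X * (Z * (seq L * seq L)) => ez (h a y.1 y.2.1 y.2.2.1 y.2.2.2))) ->
  (exists q, forall a x z d r,
     size (ez (h a x z d r)) <= size (ez z) + peval q (psize ps x + size d + size r)) ->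
  FP ps (fun x => ez (zfold (fun a z d r => h a x z d r) (g x) [::] (f x))).
Proof.
move=> leL [[qf hqf] Hf] [[qg hqg] Hg] Hh [q hq].
pose n := 'X%R : {poly nat}.
(* Bound on every accumulator: the initial size plus one increment for each of the at most [qf]
   letters. *)
pose B := (qg + qf * (q \Po (n + qf)))%R.
have zs x d r : catrev d r = f x ->
    size (ez (zstate (fun a z d r => h a x z d r) (g x) d r)) <= peval B (psize ps x).
  move=> e; have: size d + size r <= peval qf (psize ps x).
    by rewrite -size_rev -size_cat -catrevE e -size_enc hqf.
  move=> {e} hs; suff: size (ez (zstate (fun a z d r => h a x z d r) (g x) d r)) <=
     peval qg (psize ps x) + size d * peval q (psize ps x + peval qf (psize ps x)).
    move/leq_trans; apply; rewrite /B !pevalE leq_add2l leq_mul //.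
    exact: leq_trans (leq_addr _ _) hs.
  elim: d r hs => [|a d IH] r /= hs; first by rewrite mul0n addn0 hqg.
  apply: leq_trans (hq _ _ _ _ _) _; rewrite mulSn [X in _ <= _ + X]addnC addnA leq_add //.
    by apply: IH; rewrite /= addnS -addSn.
  by apply: peval_mono; rewrite -addnA leq_add2l; apply: leq_trans hs; rewrite leq_add2r.
clearbody B.
split.
  exists B => x; rewrite -[zfold _ _ _ _]/(zfold _ (zstate (fun a z d r => h a x z d r) (g x)
    [::] (f x)) _ _).
  rewrite -zstate_zfold; apply: zs.
  by rewrite !catrevE !cats0 revK.
move=> rho k sz lt; have [[cf pf] hf] := Hf rho k sz lt.
have [||[cg pg] hg] := Hg rho k.+1; first by [].
  by apply: all_ltnW lt.
(* Registers: [k] holds the unread letters, [k.+1] the accumulator, [k.+2] the letters read, [k.+3]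
   the new accumulator, and [k.+4] is scratch. The order in [rho'] is the one prescribed by
   [extend]. *)
pose rho' := [:: k.+1, k.+2, k & rho].
have [||cp hcp] := fin_all_exists (fun a => proj2 (Hh a) rho' k.+3 _ _).
- by rewrite size_extend /= sz.
- by rewrite /rho' /= !ltnS leqnn !leqnSn leqW //=; apply: all_ltnW lt; lia.
(* A letter is decoded by search; symbols that code nothing never occur in [enc] and may be
   skipped. *)
pose body (s : 'I_N.+1) := if [pick a | code a == s] is Some a
   then seqc (cp a).1 (seqc (movec k.+3 k.+1 k.+4) (push k.+2 s)) else skip.
pose P := (\sum_a (cp a).2)%R.
pose T := ((P \Po (B + qf + n)) + ((B + 1%N%:P + (B + 1%N%:P)) * 6%N%:P + 2%N%:P))%R.
exists (seqc cf (seqc cg (seqc (whilec k body) (seqc (clearc k.+2) (movec k.+1 k k.+2)))),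
  (pf + (pg + ((qf + 1%N%:P) * (T + 1%N%:P) + ((qf + 1%N%:P) * 2%N%:P + ((1%N%:P + (B + 1%N%:P))
    * 6%N%:P)))))%R) => x st hst.
have hc1 := hf _ _ hst; rewrite /= in hc1.
have hc2 := hg _ _ (stores_upd (enc (f x)) sz lt hst); rewrite /= in hc2.
pose zst := zstate (fun a z d r => h a x z d r) (g x).
pose F d r := upd (upd (upd st k (enc r)) k.+1 (ez (zst d r))) k.+2 (enc d).
have stn j : k <= j -> st j = [::] by apply: (proj2 hst).
have hw : computes (whilec k body) (F [::] (f x))
    ((size (f x)).+1 * (peval T (psize ps x)).+1) (F (rev (f x)) [::]).
  apply: (@whilec_computes_map _ _ (@code L)) => [d r|d a r es].
    by rewrite /F; updc.
  rewrite /body; case: pickP => [b /eqP/(code_inj leL) ->|/(_ a)]; last by rewrite eqxx.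
  have hs1 : stores (extend [:: (fun z => ez z.1); (fun z => enc z.2.1); (fun z => enc z.2.2)] ps)
     rho' k.+3 (x, (zst d (a :: r), (d, r))) (upd (F d (a :: r)) k (enc r)).
    split=> [|j ltj]; last by rewrite /F; updc; rewrite stn //; lia.
    rewrite size_extend => -[|[|[|i]]] /= hi; try by rewrite /F; updc.
    rewrite !addSn add0n !ltnS in hi.
    have := allP lt (nth 0 rho i); rewrite mem_nth ?sz // => /(_ isT) /= ltk.
    rewrite (nth_map (fun=> [::])) // -(proj1 hst) //.
    by rewrite /F; updc.
  have hc := hcp a _ _ hs1; rewrite /= in hc.
  rewrite psize_extend /psize /= -/(psize ps x) addn0 !size_enc in hc.
  have b1 := zs _ _ _ es.
  have b2 : size d + (size r).+1 <= peval qf (psize ps x).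
    by rewrite -[_.+1]/(size (a :: r)) -size_rev -size_cat -catrevE es -size_enc hqf.
  have b3 : size (ez (zst (a :: d) r)) <= peval B (psize ps x) by exact: zs.
  apply: (computes_ext (fun _ => erefl) _ _ (seqc_computes hc (seqc_computes
     (movec_computes _ _ _ _ _ _ _ _) (push_computes _ _ _)))).
  - by rewrite /F; upds; rewrite stn //; lia.
  - rewrite /T pevalD leq_add //.
      rewrite peval_comp; apply: leq_trans (peval_sum (fun a => (cp a).2) a _) _.
      apply: peval_mono; rewrite !pevalD /n pevalX leq_add2r -/zst.
      by apply: leq_add => //; lia.
    rewrite pevalD pevalC leq_add2r pevalM pevalC leq_mul //.
    by rewrite !pevalD pevalC /F; updc; rewrite !addn1 leq_add // ltnS.
  - by lia.
  - by lia.
  - by lia.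
  - by rewrite /F; updc; rewrite stn //; lia.
clearbody T.
apply: (computes_ext (fun _ => erefl) _ _ (seqc_computes hc1 (seqc_computes hc2
  (seqc_computes (computes_ext _ (fun _ => erefl) (leqnn _) hw) (seqc_computes (clearc_computes _ _)
  (movec_computes _ _ _ _ _ _ _ _)))))).
- rewrite /F /zst zstate_zfold; upds; rewrite stn //; lia.
- have szf : size (f x) <= peval qf (psize ps x) by rewrite -size_enc hqf.
  rewrite !pevalD !leq_add2l leq_add //.
    by rewrite pevalM !pevalD !pevalC !addn1 leq_mul // ltnS.
  rewrite leq_add //.
    by rewrite pevalM !pevalD !pevalC !addn1 leq_mul // ltnS /F; updc; rewrite size_enc size_rev.
  rewrite pevalM !pevalD !pevalC leq_mul // leq_add //.
    by rewrite /F; updc.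
  by rewrite addn1 ltnS /F; updc; apply: zs; rewrite !catrevE !cats0 revK.
- by rewrite /F; upds; rewrite stn //; lia.
- by lia.
- by lia.
- by lia.
- by updc.
Qed.

(** * Basic string functions *)

Lemma FP_const (X : Type) (ps : seq (X -> str)) (L : finType) (s : seq L) :
  FP ps (fun=> enc s).
Proof. by elim: s => [|a s IH]; [exact: FP_nil|exact: FP_push]. Qed.

Lemma FP_cons (X : Type) (ps : seq (X -> str)) (L : finType) (a : L) f :
  FP ps (fun x => enc (f x)) -> FP ps (fun x => enc (a :: f x)).
Proof. exact: FP_push. Qed.

Lemma FP_behead_enc (X : Type) (ps : seq (X -> str)) (L : finType) (f : X -> seq L) :
  FP ps (fun x => enc (f x)) -> FP ps (fun x => enc (behead (f x))).
Proof.
move=> H; apply: FP_ext (FP_behead H) => x.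
by rewrite /enc behead_map.
Qed.

Lemma FP_case (X : Type) (ps : seq (X -> str)) (L : finType) (f : X -> seq L) g :
  #|L| <= N.+1 -> FP ps (fun x => enc (f x)) -> (forall o, FP ps (g o)) ->
  FP ps (fun x => g (ohead (f x)) x).
Proof.
move=> leL Hf Hg.
pose dec (o : option 'I_N.+1) : option L := obind (fun s => [pick a | code a == s]) o.
apply: FP_ext (FP_case_raw Hf (fun o => Hg (dec o))) => x.
congr (g _ x); case: (f x) => [|a s] //=.
by case: pickP => [b /eqP /(code_inj leL) ->|/(_ a)]; rewrite ?eqxx.
Qed.

Lemma FP_if (X : Type) (ps : seq (X -> str)) (b : X -> bool) f g :
  1 < N.+1 -> FP ps (fun x => enc [:: b x]) -> FP ps f -> FP ps g ->
  FP ps (fun x => if b x then f x else g x).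
Proof.
move=> le2 Hb Hf Hg.
have := @FP_case _ ps bool (fun x => [:: b x]) (fun o => if o is Some true then f else g).
rewrite card_bool => /(_ le2 Hb) /= H.
by apply: FP_ext (H _) => [x|[[]|]] //=; case: (b x).
Qed.

Lemma FP_if_enc (X : Type) (ps : seq (X -> str)) (L : finType) (b : X -> bool) (f g : X -> seq L) :
  1 < N.+1 -> FP ps (fun x => enc [:: b x]) -> FP ps (fun x => enc (f x)) ->
  FP ps (fun x => enc (g x)) -> FP ps (fun x => enc (if b x then f x else g x)).
Proof.
by move=> le2 Hb Hf Hg; apply: FP_ext (FP_if le2 Hb Hf Hg) => x; case: (b x).
Qed.

Lemma FP_nilp (X : Type) (ps : seq (X -> str)) (L : finType) (f : X -> seq L) :
  #|L| <= N.+1 -> FP ps (fun x => enc (f x)) -> FP ps (fun x => enc [:: nilp (f x)]).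
Proof.
move=> leL Hf.
have := FP_case (g := fun o _ => enc [:: ~~ isSome o]) leL Hf.
move=> H; apply: FP_ext (H _) => [x|o]; last exact: FP_const.
by case: (f x).
Qed.

Lemma FP_negb (X : Type) (ps : seq (X -> str)) (b : X -> bool) :
  1 < N.+1 -> FP ps (fun x => enc [:: b x]) -> FP ps (fun x => enc [:: ~~ b x]).
Proof.
move=> le2 Hb; apply: FP_ext (FP_if le2 Hb (FP_const _ [:: false]) (FP_const _ [:: true])) => x.
by case: (b x).
Qed.

Lemma FP_andb (X : Type) (ps : seq (X -> str)) (a b : X -> bool) :
  1 < N.+1 -> FP ps (fun x => enc [:: a x]) -> FP ps (fun x => enc [:: b x]) ->
  FP ps (fun x => enc [:: a x && b x]).
Proof.
move=> le2 Ha Hb; apply: FP_ext (FP_if le2 Ha Hb (FP_const _ [:: false])) => x.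
by case: (a x).
Qed.

Lemma FP_orb (X : Type) (ps : seq (X -> str)) (a b : X -> bool) :
  1 < N.+1 -> FP ps (fun x => enc [:: a x]) -> FP ps (fun x => enc [:: b x]) ->
  FP ps (fun x => enc [:: a x || b x]).
Proof.
move=> le2 Ha Hb; apply: FP_ext (FP_if le2 Ha (FP_const _ [:: true]) Hb) => x.
by case: (a x).
Qed.

Lemma zfold_catrev (L : Type) (z d r : seq L) :
  zfold (fun a z _ _ => a :: z) z d r = catrev r z.
Proof. by elim: r z d => //= a r IH z d; rewrite IH. Qed.

Lemma FP_catrev (X : Type) (ps : seq (X -> str)) (L : finType) (f g : X -> seq L) :
  #|L| <= N.+1 -> FP ps (fun x => enc (f x)) -> FP ps (fun x => enc (g x)) ->
  FP ps (fun x => enc (catrev (f x) (g x))).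
Proof.
move=> leL Hf Hg.
apply: FP_ext (FP_zfold (h := fun a _ z _ _ => a :: z) leL Hf Hg _ _) => [x|a|].
- by rewrite zfold_catrev.
- by apply: FP_cons; apply: (@FP_var _ _ 0).
- by exists (1%N%:P)%R => a x z d r; rewrite pevalC addn1.
Qed.

Lemma FP_rev (X : Type) (ps : seq (X -> str)) (L : finType) (f : X -> seq L) :
  #|L| <= N.+1 -> FP ps (fun x => enc (f x)) -> FP ps (fun x => enc (rev (f x))).
Proof. by move=> leL Hf; apply: FP_catrev => //; apply: FP_const. Qed.

Lemma FP_cat (X : Type) (ps : seq (X -> str)) (L : finType) (f g : X -> seq L) :
  #|L| <= N.+1 -> FP ps (fun x => enc (f x)) -> FP ps (fun x => enc (g x)) ->
  FP ps (fun x => enc (f x ++ g x)).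
Proof.
move=> leL Hf Hg; apply: FP_ext (FP_catrev leL (FP_rev leL Hf) Hg) => x.
by rewrite catrevE revK.
Qed.

(** The fold specialised to concatenation: each position emits a string that may depend on the
    reversed prefix and on the suffix. Most later functions are brought to this form. *)
Fixpoint zcat (L M : Type) (h : L -> seq L -> seq L -> seq M) d r :=
  if r is a :: r' then h a d r' ++ zcat h (a :: d) r' else [::].

Lemma zfold_zcat (L M : Type) (h : L -> seq L -> seq L -> seq M) z d r :
  zfold (fun a z d r => z ++ h a d r) z d r = z ++ zcat h d r.
Proof. by elim: r z d => [|a r IH] z d /=; rewrite ?cats0 // IH catA. Qed.

Lemma FP_zcat (X : Type) (ps : seq (X -> str)) (L M : finType) (f : X -> seq L)
    (h : L -> X -> seq L -> seq L -> seq M) :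
  #|L| <= N.+1 -> #|M| <= N.+1 -> FP ps (fun x => enc (f x)) ->
  (forall a, FP (extend [:: (fun z => enc z.1); (fun z => enc z.2)] ps)
     (fun y : X * (seq L * seq L) => enc (h a y.1 y.2.1 y.2.2))) ->
  FP ps (fun x => enc (zcat (fun a d r => h a x d r) [::] (f x))).
Proof.
move=> leL leM Hf Hh.
apply: FP_ext (FP_zfold (ez := @enc M) (h := fun a x z d r => z ++ h a x d r) leL Hf
  (FP_const _ [::]) _ _) => [x|a|]; first by rewrite zfold_zcat.
  apply: FP_cat => //; first exact: (@FP_var _ _ 0).
  apply: (@FP_sub _ _ _ _ (fun y => (y.1, y.2.2)) (iota 1 (size ps).+2)) (Hh a).
  - by rewrite size_iota size_extend.
  - by move=> i; rewrite !size_extend => hi; rewrite nth_iota.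
  - move=> i x; rewrite size_extend => hi; rewrite nth_iota //.
    case: i hi => [|[|i]] //= hi.
    by rewrite !(nth_map (fun=> [::])).
have [q hq] := fin_all_exists (fun a => proj1 (Hh a)).
exists (\sum_a q a)%R => a x z d r; rewrite size_enc size_cat size_enc leq_add2l -size_enc.
apply: leq_trans (hq a (x, (d, r))) _; apply: leq_trans (peval_sum q a _) _.
by apply: peval_mono; rewrite psize_extend /psize /= addn0 !size_enc addnC addnA.
Qed.

Lemma zcat_flatten (L M : Type) (phi : L -> seq M) d s :
  zcat (fun a _ _ => phi a) d s = flatten (map phi s).
Proof. by elim: s d => //= a s IH d; rewrite IH. Qed.

Lemma FP_flatten_map (X : Type) (ps : seq (X -> str)) (L M : finType) (f : X -> seq L)
    (phi : L -> X -> seq M) :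
  #|L| <= N.+1 -> #|M| <= N.+1 -> FP ps (fun x => enc (f x)) ->
  (forall a, FP ps (fun x => enc (phi a x))) ->
  FP ps (fun x => enc (flatten [seq phi a x | a <- f x])).
Proof.
move=> leL leM Hf Hphi.
apply: FP_ext (FP_zcat (h := fun a x _ _ => phi a x) leL leM Hf _) => [x|a].
  by rewrite zcat_flatten.
exact: (FP_weak _ (Hphi a)).
Qed.

Lemma FP_map (X : Type) (ps : seq (X -> str)) (L M : finType) (f : X -> seq L)
    (phi : L -> M) :
  #|L| <= N.+1 -> #|M| <= N.+1 -> FP ps (fun x => enc (f x)) ->
  FP ps (fun x => enc (map phi (f x))).
Proof.
move=> leL leM Hf.
apply: FP_ext (FP_flatten_map (phi := fun a _ => [:: phi a]) leL leM Hf _) => [x|a].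
  by rewrite -[in RHS](flatten_seq1 (map phi _)) -map_comp.
exact: FP_const.
Qed.

Lemma zfold_drop (L M : Type) (z : seq M) (d r : seq L) :
  zfold (fun _ z _ _ => behead z) z d r = drop (size r) z.
Proof. by elim: r z d => [|a r IH] z d /=; rewrite ?drop0 // IH -drop1 drop_drop addn1. Qed.

Lemma FP_drop (X : Type) (ps : seq (X -> str)) (L M : finType) (f : X -> seq L)
    (g : X -> seq M) :
  #|L| <= N.+1 -> FP ps (fun x => enc (f x)) -> FP ps (fun x => enc (g x)) ->
  FP ps (fun x => enc (drop (size (f x)) (g x))).
Proof.
move=> leL Hf Hg.
apply: FP_ext (FP_zfold (h := fun a _ z _ _ => behead z) leL Hf Hg _ _) => [x|a|].
- by rewrite zfold_drop.
- by apply: FP_behead_enc; apply: (@FP_var _ _ 0).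
- exists 0%R => a x z d r; rewrite !size_enc size_behead.
  exact: leq_trans (leq_pred _) (leq_addr _ _).
Qed.

Lemma FP_nseqM (X : Type) (ps : seq (X -> str)) (m n : X -> nat) :
  FP ps (fun x => enc (nseq (m x) tt)) -> FP ps (fun x => enc (nseq (n x) tt)) ->
  FP ps (fun x => enc (nseq (m x * n x) tt)).
Proof.
move=> Hm Hn.
apply: FP_ext (FP_flatten_map (phi := fun _ x => nseq (n x) tt) _ _ Hm _) => [x||//|//].
- congr enc; elim: (m x) => [|k IH] //=.
  by rewrite IH mulSn nseqD.
- by rewrite card_unit.
- by rewrite card_unit.
Qed.

(** Horner's scheme in unary; it produces the bounds from which the rows and columns of the tableau
    are built. *)
Lemma FP_nseq_peval (X : Type) (ps : seq (X -> str)) p (n : X -> nat) :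
  FP ps (fun x => enc (nseq (n x) tt)) ->
  FP ps (fun x => enc (nseq (peval p (n x)) tt)).
Proof.
move=> Hn; elim/poly_ind: p => [|p c IH].
  by apply: FP_ext (FP_const _ ([::] : seq unit)) => x; rewrite /peval horner0.
apply: FP_ext (FP_cat (L := unit) _ (FP_nseqM IH Hn) (FP_const _ (nseq c tt))) => [x|].
  by rewrite !pevalE nseqD.
by rewrite card_unit.
Qed.

Lemma FP_nseq_const (X : Type) (ps : seq (X -> str)) (L : finType) (n : X -> nat) (a : L) :
  #|L| <= N.+1 -> FP ps (fun x => enc (nseq (n x) tt)) ->
  FP ps (fun x => enc (nseq (n x) a)).
Proof.
move=> leL Hn; apply: FP_ext (FP_map (fun=> a) _ leL Hn) => [x|].
  by rewrite map_nseq.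
by rewrite card_unit.
Qed.

Lemma FP_size (X : Type) (ps : seq (X -> str)) (L : finType) (f : X -> seq L) :
  #|L| <= N.+1 -> FP ps (fun x => enc (f x)) -> FP ps (fun x => enc (nseq (size (f x)) tt)).
Proof.
move=> leL Hf; apply: FP_ext (FP_map (fun=> tt) leL _ Hf) => [x|].
  by congr enc; elim: (f x) => //= a s ->.
by rewrite card_unit.
Qed.

Lemma FP_poly_time (I O : finType) (F : seq I -> seq O) :
  #|I| <= N.+1 -> #|O| <= N.+1 -> FP [:: @enc I] (fun x => enc (F x)) -> poly_time F.
Proof.
move=> leI leO [[qF hqF] H]; have [//|//|[c p] h] := H [:: 0] 1.
(* [K] lies above every register of [c] and differs from 1 and 2: the output tape must be the last
   one, while the result arrives in register 1 and is moved through register 2. *)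
pose K := (\max_(q : cstates c) creg q) + 3.
pose c' := seqc c (movec 1 K 2).
have creg_le (q : cstates c') : creg q <= K.
  case: q => [q|[[[]|]|[[[]|]|[[]|]]]] //=; rewrite ?/K; try lia.
  by apply: leq_trans (leq_bigmax q) (leq_addr _ _).
exists (machine_of (code_inj leI) (code_inj leO) c' K), (p + (qF + 2%N%:P) * 6%N%:P)%R => x.
apply: (@machine_of_outputs _ _ _ _ _ _ _ _ _ creg_le _ _ _
  (upd (upd (upd (upd (fun _ => [::]) 0 (enc x)) 1 (enc (F x))) 1 [::]) K (enc (F x)))); last by
    rewrite updE eqxx.
have hst : stores [:: @enc I] [:: 0] 1 x (upd (fun _ => [::]) 0 (enc x)).
  by split=> [[|i]|[|j]].
have hc := h _ _ hst; rewrite /= in hc.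
have K3 : 2 < K by rewrite /K; lia.
apply: (computes_ext (fun _ => erefl) _ _ (seqc_computes hc (movec_computes _ _ _ _ _ _ _ _))).
- by upds.
- rewrite -/(peval _ _) pevalD pevalM pevalD !pevalC; have e : size x = psize [:: @enc I] x.
    by rewrite /psize /= addn0 size_enc.
  rewrite e leq_add2l leq_mul //; have := hqF x; rewrite !updE /=.
  by updc; rewrite /=; lia.
- by lia.
- by lia.
- by lia.
- by updc.
Qed.

End FP.

(** * The closure problem as a hitting set problem *)

Lemma count_mktuple n (F : 'I_n -> bool) : count id [tuple F j | j < n] = #|[pred j | F j]|.
Proof. by rewrite /= count_map cardE {2}/enum_mem size_filter -enumT; apply: eq_count. Qed.

Lemma ternaryE f (x : 3.-tuple bool) : ternary f x =
  f (tnth x (@Ordinal 3 0 isT)) (tnth x (@Ordinal 3 1 isT)) (tnth x (@Ordinal 3 2 isT)).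
Proof.
rewrite ffunE; congr (f (tnth x _) (tnth x _) (tnth x _)); apply: val_inj; exact: inordK.
Qed.

Definition missing n (I : {set 'I_n}) : {set n.-tuple bool} :=
  [set v | [exists i in I, ~~ tnth v i]].

(* Every output coordinate in [I] equal to 1 tolerates one zero among the k + 1
   arguments, and [I] has at most k coordinates. *)
Lemma threshold_missing k n (I : {set 'I_n}) (v : 'I_k.+1 -> n.-tuple bool) :
  #|I| <= k -> (forall i, v i \in missing I) -> coordinatewise (threshold k) v \in missing I.
Proof.
move=> leI hv.
have /fin_all_exists[w hw] i : exists j, (j \in I) && ~~ tnth (v i) j.
  by have := hv i; rewrite inE => /existsP.
have: ~~ injectiveb w.
  apply/injectiveP => /card_codom; rewrite card_ord => e.
  have: #|codom w| <= #|I| by apply/subset_leq_card/subsetP => _ /codomP[i ->]; case/andP: (hw i).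
  by rewrite e ltnNge leI.
case/injectivePn => i [j ij ew].
rewrite inE; apply/existsP; exists (w i); have /andP[-> ni] := hw i.
rewrite tnth_mktuple ffunE count_mktuple -ltnNge /=.
have: #|[pred l | tnth (v l) (w i)]| <= #|~: [set i; j]|.
  apply/subset_leq_card/subsetP => l; rewrite !inE => hl.
  apply/norP; split; apply: contraL hl => /eqP ->; first by case/andP: (hw i).
  by rewrite ew; case/andP: (hw j).
move/leq_ltn_trans; apply; have := cardsC [set i; j].
by rewrite cards2 ij card_ord /=; lia.
Qed.

(** This lets [k = 2] share the threshold argument with [3 <= k]. *)
Lemma majE : maj = threshold 2.
Proof.
apply/ffunP => x; rewrite ternaryE ffunE; case/tupleP: x => a x; case/tupleP: x => b x.
case/tupleP: x => c x; rewrite tuple0 !(tnth_nth false) /=.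
by case: a; case: b; case: c.
Qed.

(** By induction on the construction of the operation. As [and_or] lies below its first argument, a
    zero of that argument survives at the same coordinate. *)
Lemma S10_missing k n (I : {set 'I_n}) : #|I| <= k -> closed_under (S10 k) (missing I).
Proof.
move=> leI t f v Hf; elim: Hf n I leI v => {t f} [t f Ff|t j|t m f g _ IHf _ IHg] n I leI v hv.
- case: Ff v hv => [_|k2|k2] v hv; first exact: threshold_missing.
    by rewrite majE; apply: threshold_missing => //; rewrite -k2.
  have := hv (@Ordinal 3 0 isT); rewrite !inE => /existsP[i /andP[iI ni]].
  apply/existsP; exists i; rewrite iI tnth_mktuple ternaryE !tnth_mktuple.
  by rewrite (negbTE ni).
- rewrite (_ : coordinatewise _ v = v j) //.
  by apply: eq_from_tnth => i; rewrite tnth_mktuple ffunE tnth_mktuple.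
- have := IHf _ _ leI (fun i => coordinatewise (g i) v) (fun i => IHg i _ _ leI v hv).
  rewrite (_ : coordinatewise f _ = coordinatewise (compose f g) v) //.
  apply: eq_from_tnth => i; rewrite !tnth_mktuple ffunE; congr (f _).
  by apply: eq_from_tnth => l; rewrite !tnth_mktuple.
Qed.

Lemma S10_has_threshold k : 2 <= k -> S10 k (threshold k).
Proof.
rewrite leq_eqVlt => /predU1P[<-|k3]; last by apply: clone_gen; apply: S10_threshold.
by rewrite -majE; apply: clone_gen; apply: S10_maj.
Qed.

Lemma Cl_all_ones k n (S : {set n.-tuple bool}) : 2 <= k ->
  Cl (S10 k) S (all_ones n) <->
  forall I : {set 'I_n}, #|I| <= k -> exists2 v, v \in S & forall i, i \in I -> tnth v i.
Proof.
move=> k2; split=> [H I leI|H A SA clA].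
  apply: NNPP => nv.
  have: all_ones n \in missing I.
    apply: H; last exact: S10_missing.
    apply/subsetP => v vS; rewrite inE; apply/existsP; apply: NNPP => nh.
    apply: nv; exists v => // i iI; apply/negPn/negP => ni.
    by apply: nh; exists i; rewrite iI.
  by rewrite inE => /existsP[i]; rewrite tnth_nseq andbF.
(* Induction on a bound for [#|I|], ending at the full set of coordinates: up to size [k] the
   hypothesis applies, and a larger [I] is covered by [k.+1] vectors, each allowed to fail at one
   point of its own. *)
suff HA m (I : {set 'I_n}) : #|I| <= m -> exists2 v, v \in A & forall i, i \in I -> tnth v i.
  have [v vA hv] := HA _ setT (leqnn _).
  rewrite (_ : all_ones n = v) //; apply: eq_from_tnth => i.
  by rewrite tnth_nseq hv ?inE.
elim: m I => [|m IH] I leI.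
  have [|v vS hv] := H I; first exact: leq_trans leI _.
  by exists v => //; apply: (subsetP SA).
have [lek|ltk] := leqP #|I| k.
  have [//|v vS hv] := H I; exists v => //; exact: (subsetP SA).
pose w (j : 'I_k.+1) : 'I_n := enum_val (widen_ord ltk j).
have wI j : w j \in I by apply: enum_valP.
have w_inj : injective w.
  by move=> i j /enum_val_inj /(congr1 val) /= e; apply: val_inj.
have /fin_all_exists[v hv] j : exists v, v \in A /\ forall i, i \in I :\ w j -> tnth v i.
  have [|v vA h] := IH (I :\ w j); last by exists v.
  by move: leI; rewrite (cardsD1 (w j)) wI.
exists (coordinatewise (threshold k) v).
  by apply: clA (S10_has_threshold k2) _ => j; case: (hv j).
move=> i iI; rewrite tnth_mktuple ffunE count_mktuple.
(* On [I], vector [v j] can vanish only at [w j], and [w] is injective, so at most one argument is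
   zero at [i]. *)
have: #|[pred j | ~~ tnth (v j) i]| <= 1.
  apply/card_le1_eqP => a b; rewrite !inE => ha hb; apply: w_inj.
  have wi c : ~~ tnth (v c) i -> w c = i.
    move=> nc; apply/eqP/negPn/negP => ne; move/negP: nc; apply.
    by apply: (proj2 (hv c)); rewrite !inE eq_sym ne.
  by rewrite (wi a) // (wi b).
rewrite (eq_card (B := predC [pred j | tnth (v j) i])) // => le1.
have: k.+1 <= #|[pred j | tnth (v j) i]| + 1; last by rewrite addn1.
rewrite -[X in X <= _]card_ord -(cardC [pred j | tnth (v j) i]).
by rewrite leq_add2l.
Qed.

(** * Words and their blocks *)

Fixpoint blocks (w : seq (option bool)) : seq (seq bool) :=
  match w with
  | [::] => [::]
  | None :: w' => nonblank_prefix w' :: blocks w'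
  | Some _ :: w' => blocks w'
  end.

Definition join (kb : seq bool) (bs : seq (seq bool)) : seq (option bool) :=
  map Some kb ++ flatten [seq None :: map Some v | v <- bs].

(** Parsing never fails: with the two lemmas below, arbitrary words correspond bijectively to a
    prefix together with a list of blocks. *)
Lemma join_blocks w : join (nonblank_prefix w) (blocks w) = w.
Proof. by elim: w => [|[b|] w IH] //=; rewrite -[in RHS]IH. Qed.

Lemma nonblank_prefix_join kb bs : nonblank_prefix (join kb bs) = kb.
Proof. by elim: kb => [|b kb IH] /=; [case: bs|rewrite IH]. Qed.

Lemma blocks_join kb bs : blocks (join kb bs) = bs.
Proof.
elim: kb => [|b kb IH] //=; elim: bs => [|v bs IH] //=.
rewrite -[_ ++ _]/(join v bs) nonblank_prefix_join; congr cons.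
by elim: v => [|b v IHv].
Qed.

(** The value of a binary expansion, least significant bit first. *)
Definition bits_val (s : seq bool) : nat := foldr (fun (b : bool) n => b + n.*2) 0 s.

Lemma rev_binary k : 1 < k -> rev (binary k) = odd k :: rev (binary k./2).
Proof.
move=> k1; rewrite /binary !revK trunc_log2S //; set m := (trunc_log 2 k./2).+1.
rewrite -[iota 0 m.+1]/(0 :: iota (1 + 0) m) (iotaDl 1 0 m) map_cons -map_comp expn0 divn1.
by congr cons; apply: eq_map => i /=; rewrite add1n expnS divnMA divn2.
Qed.

Lemma bits_val_binary k : bits_val (rev (binary k)) = k.
Proof.
elim/ltn_ind: k => -[|[|k]] IH //.
have e := IH k.+2./2; rewrite rev_binary //.
rewrite -[bits_val _]/(odd k.+2 + (bits_val (rev (binary k.+2./2))).*2) e.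
  exact: odd_double_half.
by lia.
Qed.

Lemma size_binary k : size (binary k) = (trunc_log 2 k).+1.
Proof. by rewrite size_rev size_map size_iota. Qed.

Lemma head_binary k : 0 < k -> head false (binary k).
Proof.
rewrite -(revK (binary k)); elim/ltn_ind: k => -[|[|k]] IH // _.
rewrite rev_binary // rev_cons.
have: head false (rev (rev (binary k.+2./2))).
  by apply: IH => //; lia.
by case: (rev (rev _)).
Qed.

Lemma bits_val_gt0 s : last false s -> 0 < bits_val s.
Proof.
suff H b : last b s -> 0 < b + bits_val s by move/H.
elim: s b => [|c s IH] b /=; first by case: b.
by move/IH; lia.
Qed.

(** The expansions of positive integers are exactly the strings with leading bit 1, so having the
    form [binary k] becomes a test of one letter. *)
Lemma binary_bits_val s : last false s -> rev (binary (bits_val s)) = s.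
Proof.
elim: s => [//|b s IH].
case: s IH => [|c s] IH; first by case: b.
move=> l; have e := IH l; have g := bits_val_gt0 (l : last false (c :: s)).
have -> : bits_val [:: b, c & s] = b + (bits_val (c :: s)).*2 by [].
rewrite rev_binary; last by lia.
by rewrite half_bit_double oddD odd_double addbF oddb e.
Qed.

(** These conditions characterise the encodings with [2 <= k]: given a leading 1, having at least
    two digits means exactly that, and the first block supplies the dimension for all others. *)
Definition valid_word w :=
  [&& head false (nonblank_prefix w), 1 < size (nonblank_prefix w), ~~ nilp (blocks w),
      all id (head [::] (blocks w)) &
      all (fun v => size v == size (head [::] (blocks w))) (behead (blocks w))].

Definition hits (u v : seq bool) := has (fun ab => ab.1 && ~~ ab.2) (zip u v).

Lemma hitsP n (u v : seq bool) : size u = n -> size v = n ->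
  reflect (exists2 i, i < n & nth false u i && ~~ nth false v i) (hits u v).
Proof.
move=> su sv; have sz : size (zip u v) = n by rewrite size1_zip su ?sv.
apply: (iffP (has_nthP (false, false))) => -[i]; rewrite ?sz => hi hb; exists i; rewrite ?sz //.
  by move: hb; rewrite nth_zip ?su ?sv.
by rewrite nth_zip ?su ?sv.
Qed.

Lemma count_nth n (u : seq bool) : size u = n -> count id u = #|[set i : 'I_n | nth false u i]|.
Proof.
move=> su; rewrite cardsE cardE {1}/enum_mem size_filter -enumT.
rewrite -{1}[u](mkseq_nth false) su /mkseq -val_enum_ord -map_comp count_map.
by apply: eq_count.
Qed.

(** A reformulation on raw words, free of dimensions in types, that serves the verifier and the
    reduction alike; [u] is the indicator vector of a candidate hitting set. *)
Lemma ClosureThresholdP w : ClosureThreshold w <->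
  valid_word w /\ forall u, size u = size (head [::] (blocks w)) ->
    count id u <= bits_val (rev (nonblank_prefix w)) -> ~~ all (hits u) (behead (blocks w)).
Proof.
split=> [[n [k [S [s [k2 eS -> /Cl_all_ones H]]]]]|[]].
  have -> : encode k s = join (binary k) (map (@tval n bool) (all_ones n :: s)).
    by rewrite /encode /join -map_comp.
  rewrite /valid_word nonblank_prefix_join blocks_join /= bits_val_binary; split.
    rewrite head_binary ?(ltnW k2) // size_binary ltnS trunc_log_gt0 k2 /=.
    rewrite (eq_all (a2 := pred1 true)) ?all_pred1_nseq; last by case.
    by apply/allP => _ /mapP[v _ ->]; rewrite size_tuple size_nseq.
  rewrite size_nseq => u su cu.
  have [|v vS hv] := H k2 [set i : 'I_n | nth false u i]; first by rewrite -count_nth.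
  apply/negP => /allP/(_ (@tval n bool v)); rewrite map_f -?eS // => /(_ isT).
  case/(hitsP su (size_tuple v)) => i hi /andP[ui]; apply/negP/negPn.
  by have := hv (Ordinal hi); rewrite inE (tnth_nth false) /=; apply.
case/and5P => hk sk; case eb: (blocks w) => [|ones vs] //= _ h1 hv H.
set n := size ones in hv H *; set kb := nonblank_prefix w in hk sk H.
set k := bits_val (rev kb) in H.
have ek : binary k = kb.
  apply: (can_inj revK); apply: binary_bits_val.
  by case: (kb) hk => //= b s; rewrite rev_cons last_rcons.
have k2 : 1 < k.
  by move: sk; rewrite -ek size_binary ltnS trunc_log_gt0.
pose s := [seq insubd (nseq_tuple n false) v | v <- vs].
have es : map (@tval n bool) s = vs.
  rewrite -map_comp -[RHS]map_id; apply/eq_in_map => v /(allP hv) sv /=.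
  exact: insubdK.
exists n, k, [set x in s], s; split=> // [x||]; first by rewrite inE.
  have -> : encode k s = join (binary k) (map (@tval n bool) (all_ones n :: s)).
    by rewrite /encode /join -map_comp.
  rewrite ek /= es -[LHS]join_blocks eb; congr (join _ (_ :: _)).
  by rewrite -/n; apply/all_pred1P; rewrite (eq_all (a2 := id)) // => -[].
apply/Cl_all_ones => // I leI.
pose u := mkseq (fun i => [exists j in I, j == i :> nat]) n.
have uI : [set i : 'I_n | nth false u i] = I.
  apply/setP => i; rewrite inE nth_mkseq //; apply/existsP/idP => [[j /andP[jI /eqP/val_inj
    <-]]//|iI].
  by exists i; rewrite iI eqxx.
have := H u; rewrite size_mkseq (count_nth (size_mkseq _ _)) uI => /(_ erefl leI).
rewrite -es => /allPn[_ /mapP[v vs' ->]] nh; exists v; first by rewrite inE.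
move=> i; rewrite -uI inE => ui; apply/negPn/negP => nv; move/negP: nh; apply.
by apply/(hitsP (size_mkseq _ _) (size_tuple v)); exists i; rewrite // ui -tnth_nth.
Qed.

(** * Binary counters *)

Fixpoint bits_inc (s : seq bool) : seq bool :=
  match s with
  | [::] => [:: true]
  | true :: s' => false :: bits_inc s'
  | false :: s' => true :: s'
  end.

Lemma bits_val_inc s : bits_val (bits_inc s) = (bits_val s).+1.
Proof. by elim: s => [|[] s IH] //=; rewrite ?IH; lia. Qed.

Lemma bits_val_iter_inc n s : bits_val (iter n bits_inc s) = bits_val s + n.
Proof. by elim: n => [|n IH] /=; rewrite ?addn0 // bits_val_inc IH addnS. Qed.

Lemma bits_val_lt s : bits_val s < 2 ^ size s.
Proof. by elim: s => [|b s IH] //=; rewrite expnS; case: b; lia. Qed.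

Lemma size_bits_inc s : size (bits_inc s) <= (size s).+1.
Proof. by elim: s => [|[] s IH] //=. Qed.

Lemma size_bits_inc_lt s : (bits_val s).+1 < 2 ^ size s -> size (bits_inc s) = size s.
Proof.
elim: s => [|[] s IH] //=; rewrite expnS => h; rewrite IH //.
by move: h; rewrite -/(bits_val s); lia.
Qed.

(** As long as the value fits, an increment keeps the length, so overflow is visible without
    computing any value. *)
Lemma size_iter_inc n s : (size (iter n bits_inc s) == size s) = (bits_val s + n < 2 ^ size s).
Proof.
apply/eqP/idP => [e|]; first by rewrite -bits_val_iter_inc -e bits_val_lt.
elim: n => [|n IH] //= h; have e : size (iter n bits_inc s) = size s by apply: IH; lia.
by rewrite size_bits_inc_lt // e bits_val_iter_inc; lia.
Qed.

Lemma bits_val_negb s : (bits_val (map negb s) + bits_val s).+1 = 2 ^ size s.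
Proof. by elim: s => [|b s IH] //=; rewrite expnS -IH; case: b => /=; lia. Qed.

(* A counter started at the complement of [s] first overflows at step [bits_val s + 1]. *)
Lemma count_le_bits_val n s :
  (n <= bits_val s) = (size (iter n bits_inc (map negb s)) == size s).
Proof. by rewrite -(size_map negb s) size_iter_inc size_map -bits_val_negb; lia. Qed.

Lemma last_bits_inc s : nilp s || last false s -> last false (bits_inc s).
Proof.
case: s => [|b s] //=; elim: s b => [|c s IH] [] //= h.
by have := IH c h; case: c {h}.
Qed.

(** A counter started from the empty string never acquires a leading zero, so it displays a
    canonical expansion. *)
Lemma last_iter_inc n : 0 < n -> last false (iter n bits_inc [::]).
Proof.
elim: n => [|n IH] // _; rewrite iterS; apply: last_bits_inc.
by case: n IH => [|n] IH //; rewrite IH ?orbT.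
Qed.

(** Carry look-ahead: with low bits first, a bit flips exactly when all earlier bits are 1. This
    makes incrementing a positionwise function of the prefix, up to one final bit. *)
Definition carry_in (b : bool) (d : seq bool) := if all id d then ~~ b else b.

Lemma bits_incE s : bits_inc s =
  zcat (fun b d _ => [:: carry_in b d]) [::] s ++ (if all id s then [:: true] else [::]).
Proof.
suff H d r : all id d -> bits_inc r =
    zcat (fun b d _ => [:: carry_in b d]) d r ++ (if all id r then [:: true] else [::]) by exact: H.
elim: r d => [|b r IH] d //= hd; rewrite /carry_in hd.
case: b => /=; first by rewrite (IH (true :: d)).
rewrite cats0; congr cons.
have: ~~ all id (false :: d) by [].
elim: r (false :: d) {IH hd} => [|c r IH] e //= ne.
by rewrite (negbTE ne) -IH //= (negbTE ne) andbF.
Qed.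

(** * Checking a hitting set in polynomial time *)

Section Verifier.
Variable N : nat.
Hypothesis N_ge : 6 <= N.
Notation str := (seq 'I_N.+1).

(** A universal test emits a token for each failure and checks that nothing was emitted. The test on
    all blocks uses the same device, and [hits] its dual. *)
Lemma FP_all (X : Type) (ps : seq (X -> str)) (L : finType) (p : pred L) (f : X -> seq L) :
  #|L| <= N.+1 -> FP ps (fun x => enc N (f x)) -> FP ps (fun x => enc N [:: all p (f x)]).
Proof.
move=> leL Hf.
apply: FP_ext (FP_nilp (L := unit) _ (FP_flatten_map (phi := fun a _ => if p a then [::] else [::
  tt]) leL _ Hf _)) => [x|||a]; try by cardle.
  by congr enc; congr cons; elim: (f x) => //= a s <-; case: (p a).
exact: FP_const.
Qed.

Lemma FP_bits_inc (X : Type) (ps : seq (X -> str)) (f : X -> seq bool) :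
  FP ps (fun x => enc N (f x)) -> FP ps (fun x => enc N (bits_inc (f x))).
Proof.
move=> Hf; apply: FP_ext (FP_cat (L := bool) _ (FP_zcat (h := fun b _ d _ => [:: carry_in b d]) _
  _ Hf _)
  (FP_if_enc _ (FP_all id _ Hf) (FP_const _ [:: true]) (FP_const _ [::]))) => [x||||b||]; try by
    cardle.
  by rewrite bits_incE; case: (all id (f x)).
apply: FP_ext (FP_if (b := fun y => all id y.2.1) _ _ (FP_const _ [:: ~~ b]) (FP_const _ [:: b]))
  => [y||]; try by cardle.
  by rewrite /carry_in; case: all.
by apply: FP_all; [cardle|apply: (@FP_var _ _ _ 0)].
Qed.

Lemma zfold_iter_inc (L : Type) (p : pred L) z d r :
  zfold (fun a z _ _ => if p a then bits_inc z else z) z d r = iter (count p r) bits_inc z.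
Proof.
by elim: r z d => [|a r IH] z d //=; rewrite IH; case: (p a); rewrite //= -iterSr.
Qed.

Lemma FP_iter_inc (X : Type) (ps : seq (X -> str)) (L : finType) (p : pred L)
    (f : X -> seq L) (g : X -> seq bool) :
  #|L| <= N.+1 -> FP ps (fun x => enc N (f x)) -> FP ps (fun x => enc N (g x)) ->
  FP ps (fun x => enc N (iter (count p (f x)) bits_inc (g x))).
Proof.
move=> leL Hf Hg.
apply: FP_ext (FP_zfold (h := fun a _ z _ _ => if p a then bits_inc z else z) leL Hf Hg _ _) =>
  [x|a|].
- by rewrite zfold_iter_inc.
- by case: (p a); [apply: FP_bits_inc|]; apply: (@FP_var _ _ _ 0).
- exists (1%N%:P)%R => a x z d r; rewrite pevalC !size_enc addn1.
  by case: (p a); [exact: size_bits_inc|].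
Qed.

Lemma FP_eq_size (X : Type) (ps : seq (X -> str)) (L M : finType) (f : X -> seq L) (g : X -> seq
  M) :
  #|L| <= N.+1 -> #|M| <= N.+1 ->
  FP ps (fun x => enc N (f x)) -> FP ps (fun x => enc N (g x)) ->
  FP ps (fun x => enc N [:: size (f x) == size (g x)]).
Proof.
move=> leL leM Hf Hg.
apply: FP_ext (FP_andb _ (FP_nilp leM (FP_drop leL Hf Hg)) (FP_nilp leL (FP_drop leM Hg Hf))) =>
  [x|]; last by cardle.
by rewrite /nilp !size_drop !subn_eq0 andbC -eqn_leq.
Qed.

Lemma nonblank_prefix_zcat w : nonblank_prefix w =
  zcat (fun (a : option bool) d _ => if a is Some b then if all isSome d then [:: b] else [::]
    else [::])
    [::] w.
Proof.
set h := fun _ _ _ => _; suff H d r : zcat h d r = if all isSome d then nonblank_prefix r else [::].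
  by rewrite H.
elim: r d => [|[b|] r IH] d /=; rewrite ?IH /=; first by case: all.
  by case: all.
by case: all.
Qed.

Lemma FP_nonblank_prefix (X : Type) (ps : seq (X -> str)) (f : X -> seq (option bool)) :
  FP ps (fun x => enc N (f x)) -> FP ps (fun x => enc N (nonblank_prefix (f x))).
Proof.
move=> Hf; apply: FP_ext (FP_zcat (M := bool) (h := fun (a : option bool) _ d _ =>
   if a is Some b then if all isSome d then [:: b] else [::] else [::]) _ _ Hf _) => [x|||[b|]];
     try by cardle.
- by rewrite nonblank_prefix_zcat.
- apply: FP_ext (FP_if (b := fun y => all isSome y.2.1) _ _ (FP_const _ [:: b]) (FP_const _
  [::])) => [y||]; try by cardle.
    by case: all.
  by apply: FP_all; [cardle|apply: (@FP_var _ _ _ 0)].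
- exact: FP_const.
Qed.

(** A block is what follows a [#], so the fold applies the test at each [#], to the prefix of the
    unread part. *)
Lemma all_blocks_zcat (p : pred (seq bool)) d w : all p (blocks w) =
  nilp (zcat (fun (a : option bool) _ r => if a is None then
     if p (nonblank_prefix r) then [::] else [:: tt] else [::]) d w).
Proof. by elim: w d => [|[b|] w IH] d //=; rewrite (IH (None :: d)); case: (p _). Qed.

Lemma FP_all_blocks (X : Type) (ps : seq (X -> str)) (f : X -> seq (option bool))
    (p : X -> seq bool -> bool) :
  FP ps (fun x => enc N (f x)) ->
  FP (extend [:: (fun z => enc N z.1); (fun z => enc N z.2)] ps)
    (fun y : X * (seq (option bool) * seq (option bool)) => enc N [:: p y.1 (nonblank_prefix
      y.2.2)]) ->
  FP ps (fun x => enc N [:: all (p x) (blocks (f x))]).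
Proof.
move=> Hf Hp; apply: FP_ext (FP_nilp (L := unit) _ (FP_zcat (h := fun (a : option bool) x _ r =>
  if a is None then if p x (nonblank_prefix r) then [::] else [:: tt] else [::]) _ _ Hf _))
  => [x||||[b|]]; try by cardle.
- by rewrite -all_blocks_zcat.
- exact: FP_const.
- apply: FP_ext (FP_if _ Hp (FP_const _ [::]) (FP_const _ [:: tt])) => [y|]; last by cardle.
  by case: (p _ _).
Qed.

(** Removing the prefix with its separator turns the block [1^n] into the prefix, so the same two
    accessors also reach the head and the tail of the list of blocks. *)
Definition after_block (w : seq (option bool)) := behead (drop (size (nonblank_prefix w)) w).

Lemma FP_after_block (X : Type) (ps : seq (X -> str)) (f : X -> seq (option bool)) :
  FP ps (fun x => enc N (f x)) -> FP ps (fun x => enc N (after_block (f x))).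
Proof.
move=> Hf; apply: FP_behead_enc; apply: FP_drop => //; first by cardle.
exact: FP_nonblank_prefix.
Qed.

Lemma blocks_after w : blocks (after_block w) = behead (blocks w).
Proof.
by rewrite /after_block; elim: w => [|[b|] w IH] //=; rewrite drop0.
Qed.

Lemma nonblank_prefix_after w : nonblank_prefix (after_block w) = head [::] (blocks w).
Proof. by rewrite /after_block; elim: w => [|[b|] w IH] //=; rewrite drop0. Qed.

Lemma nilp_blocks w : nilp (blocks w) = nilp (drop (size (nonblank_prefix w)) w).
Proof. by elim: w => [|[b|] w IH]. Qed.

(** While [v] is read, the length of its prefix is the current index; dropping that many bits of [u]
    aligns the two strings. *)
Lemma hits_zcat u v : hits u v =
  ~~ nilp (zcat (fun (b : bool) d _ => if b then [::] else
     if ohead (drop (size d) u) is Some true then [:: tt] else [::]) [::] v).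
Proof.
suff H d r : hits (drop (size d) u) r = ~~ nilp (zcat (fun (b : bool) d _ => if b then [::] else
     if ohead (drop (size d) u) is Some true then [:: tt] else [::]) d r) by rewrite -(H [::])
       drop0.
elim: r d => [|b r IH] d /=; first by rewrite /hits; case: drop.
move: (IH (b :: d)); rewrite /= -addn1 addnC -drop_drop drop1.
case: (drop _ u) => [|c s] /=; first by case: (b) => /= <-; rewrite /hits; case: (r).
by case: b c => -[] //=; rewrite /hits.
Qed.

Lemma FP_hits (X : Type) (ps : seq (X -> str)) (f g : X -> seq bool) :
  FP ps (fun x => enc N (f x)) -> FP ps (fun x => enc N (g x)) ->
  FP ps (fun x => enc N [:: hits (f x) (g x)]).
Proof.
move=> Hf Hg; apply: FP_ext (FP_negb _ (FP_nilp (L := unit) _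
  (FP_zcat (h := fun (b : bool) x d _ => if b then [::] else
     if ohead (drop (size d) (f x)) is Some true then [:: tt] else [::]) _ _ Hg _)))
  => [x|||||[]]; try by cardle.
- by rewrite hits_zcat.
- exact: FP_const.
- apply: FP_ext (FP_case (f := fun y => drop (size y.2.1) (f y.1)) (g := fun o _ =>
    if o is Some true then enc N [:: tt] else enc N ([::] : seq unit)) _ _ _) => [y||| [[]|]];
      try by cardle.
  + by case: ohead => // -[].
  + by apply: FP_drop; [cardle|exact: (@FP_var _ _ _ 0)|exact: (FP_weak _ Hf)].
  + exact: FP_const.
  + exact: FP_nil.
  + exact: FP_nil.
Qed.

Lemma FP_valid_word (X : Type) (ps : seq (X -> str)) (f : X -> seq (option bool)) :
  FP ps (fun x => enc N (f x)) -> FP ps (fun x => enc N [:: valid_word (f x)]).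
Proof.
move=> Hf; have Hk := FP_nonblank_prefix Hf; have Ha := FP_after_block Hf.
rewrite /valid_word; apply: FP_andb; first by cardle.
  apply: FP_ext (FP_case (g := fun o _ => enc N [:: o == Some true]) _ Hk _) => [x||o].
  - by case: nonblank_prefix => // -[].
  - by cardle.
  - exact: FP_const.
apply: FP_andb; first by cardle.
  apply: FP_ext (FP_negb _ (FP_nilp (L := bool) _ (FP_behead_enc Hk))) => [x||]; try by cardle.
  by case: nonblank_prefix => [|b []].
apply: FP_andb; first by cardle.
  apply: FP_ext (FP_negb _ (FP_nilp (L := option bool) _ (FP_drop (L := bool) _ Hk Hf))) =>
    [x|||]; try by cardle.
  by rewrite nilp_blocks.
apply: FP_andb; first by cardle.
  apply: FP_ext (FP_all (L := bool) id _ (FP_nonblank_prefix Ha)) => [x|]; last by cardle.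
  by rewrite nonblank_prefix_after.
apply: FP_ext (FP_all_blocks (p := fun x v => size v == size (nonblank_prefix (after_block (f
  x)))) Ha _) => [x|].
  by rewrite nonblank_prefix_after blocks_after.
apply: (@FP_eq_size _ _ bool bool); try by cardle.
  by apply: FP_nonblank_prefix; apply: (@FP_var _ _ _ 1).
exact: (FP_weak _ (FP_nonblank_prefix Ha)).
Qed.

(** A malformed word belongs to the complement, hence it is accepted with any certificate. *)
Definition accepts (w : seq (option bool)) (u : seq bool) :=
  ~~ valid_word w || [&& size u == size (head [::] (blocks w)), all (hits u) (behead (blocks w)) &
    count id u <= bits_val (rev (nonblank_prefix w))].

Lemma FP_accepts (X : Type) (ps : seq (X -> str)) f g :
  FP ps (fun x => enc N (f x)) -> FP ps (fun x => enc N (g x)) ->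
  FP ps (fun x => enc N [:: accepts (f x) (g x)]).
Proof.
move=> Hf Hg; have Hk := FP_nonblank_prefix Hf; have Ha := FP_after_block Hf.
apply: FP_orb; first by cardle.
  by apply: FP_negb; [cardle|exact: FP_valid_word].
apply: FP_andb; first by cardle.
  apply: FP_ext (FP_eq_size (L := bool) _ _ Hg (FP_nonblank_prefix Ha)) => [x||]; try by cardle.
  by rewrite nonblank_prefix_after.
apply: FP_andb; first by cardle.
  apply: FP_ext (FP_all_blocks (p := fun x v => hits (g x) v) Ha _) => [x|].
    by rewrite blocks_after.
  apply: FP_hits; first exact: (FP_weak _ Hg).
  by apply: FP_nonblank_prefix; apply: (@FP_var _ _ _ 1).
have Hr : FP ps (fun x => enc N (rev (nonblank_prefix (f x)))) by apply: FP_rev => //; cardle.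
apply: FP_ext (FP_eq_size (L := bool) _ _
  (FP_iter_inc (L := bool) id _ Hg (FP_map (M := bool) negb _ _ Hr)) Hr) => [x|||||]; try by cardle.
by rewrite -count_le_bits_val.
Qed.

End Verifier.

(** * Membership in coNP *)

Definition word_of (z : seq (option (option bool + bool))) :=
  flatten [seq if a is Some (inl c) then [:: c] else [::] | a <- z].

Definition cert_of (z : seq (option (option bool + bool))) :=
  flatten [seq if a is Some (inr b) then [:: b] else [::] | a <- z].

Lemma word_of_with w u : word_of (with_certificate w u) = w.
Proof.
rewrite /word_of /with_certificate map_cat flatten_cat /= -!map_comp.
rewrite [X in _ ++ X](_ : _ = [::]); last by elim: u.
by rewrite cats0; elim: w => //= a w ->.
Qed.

Lemma cert_of_with w u : cert_of (with_certificate w u) = u.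
Proof.
rewrite /cert_of /with_certificate map_cat flatten_cat /= -!map_comp.
rewrite [X in X ++ _](_ : _ = [::]); last by elim: w.
by elim: u => //= a u ->.
Qed.

Lemma size_head_blocks w : size (head [::] (blocks w)) <= size w.
Proof.
rewrite -nonblank_prefix_after /after_block.
suff H (s : seq (option bool)) : size (nonblank_prefix s) <= size s.
  by apply: leq_trans (H _) _; rewrite size_behead size_drop; lia.
by elim: s => [|[b|] s IH].
Qed.

Lemma ClosureThreshold_in_coNP : in_coNP ClosureThreshold.
Proof.
(* The certificate is as long as the block [1^n], which is part of [w], so the identity polynomial
   bounds its size. *)
exists (fun z => accepts (word_of z) (cert_of z)), 'X%R; split.
  exists (fun z => accepts (word_of z) (cert_of z)); split=> //.
  have cI : #|{: option (option bool + bool)}| <= 7.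
    by rewrite ?card_option ?card_sum ?card_option ?card_bool.
  apply: (@FP_poly_time 6) => //; first by rewrite card_bool.
  apply: FP_accepts => //; apply: FP_flatten_map => //; try exact: (@FP_var _ _ _ 0);
    rewrite ?card_option ?card_bool // => a; exact: FP_const.
move=> w; rewrite /complement ClosureThresholdP; split=> [nC|[u [_]]].
  case v: (valid_word w); last first.
    exists [::]; split=> //; rewrite word_of_with /accepts v //.
  apply: NNPP => nu; apply: nC; split=> // u su cu; apply/negP => hu; apply: nu.
  exists u; split; first by rewrite hornerX su size_head_blocks.
  by rewrite word_of_with cert_of_with /accepts v su eqxx hu cu.
rewrite word_of_with cert_of_with /accepts => h [v H]; move: h; rewrite v /=.
by case/and3P => /eqP su hu cu; have := H u su cu; rewrite hu.
Qed.

(** * The computation tableau *)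

(** Constraint on the cells around position [p] of row [t] of a tableau: one of
    the cells at the start of the row, at [p - 1], [p], [p + 1], or at [p] in row
    [t + 1] lies in the given set; a missing cell does not count. *)
Record clause (G : finType) := Clause {
  on_first : {set G}; on_left : {set G}; on_cur : {set G};
  on_right : {set G}; on_next : {set G}
}.

Definition sat_clause (G : finType) (a : nat -> nat -> G) R C t p (cl : clause G) :=
  [|| a t 0 \in on_first cl, (0 < p) && (a t p.-1 \in on_left cl), a t p \in on_cur cl,
      (p.+1 < C) && (a t p.+1 \in on_right cl) | (t.+1 < R) && (a t.+1 p \in on_next cl)].

Definition rowL : finType := option bool.
Definition LFirst : rowL := Some true.
Definition LMid : rowL := None.
Definition LLast : rowL := Some false.

(** The control column also carries a letter, since the head scans the first input letter at the
    start. Sums and options of known types supply the finite type structure. *)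
Definition colL (I : finType) : finType := ((bool * I) + option bool)%type.
Definition LCtrl {I : finType} (o : I) : colL I := inl (true, o).
Definition LFix {I : finType} (o : I) : colL I := inl (false, o).
Definition LGuess {I : finType} : colL I := inr None.
Definition LBlank {I : finType} : colL I := inr (Some true).
Definition LEnd {I : finType} : colL I := inr (Some false).

Lemma nonblank_prefix_chain (A : Type) (g : seq (option A)) :
  (forall j, nth None g j = None -> nth None g j.+1 = None) ->
  forall j, nth None g j = nth None (map Some (nonblank_prefix g)) j.
Proof.
elim: g => [|[b|] g IH] H j //=.
  case: j => //= j; apply: IH => i; exact: (H i.+1).
rewrite nth_nil; elim: j => [|j IHj] //; exact: H.
Qed.

Section Tableau.
Variables (A : finType) (M : machine (option (A + bool)) bool).
Notation K := (extra_tapes M).+1.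
Notation symbols := (K.-tuple (option (sym M))).

(** A row describes a configuration: first a control cell with the state and the
    scanned symbols, then one cell for each depth [p], with the symbols at depth
    [p] of the left and right parts of all tapes, and finally an end marker
    [None]. *)
Definition cellT : finType := option ((state M * symbols) + (symbols * symbols)).

(** The default [d] is used at the control cell and at the end marker: a symbol entering a stack at
    depth 0 is the one just written, and what comes in from beyond the last depth is blank. *)
Definition left_sym (c : cellT) i d : option (sym M) :=
  if c is Some (inr lr) then tnth lr.1 i else d.
Definition right_sym (c : cellT) i d : option (sym M) :=
  if c is Some (inr lr) then tnth lr.2 i else d.

Definition action (q : state M) (h : symbols) : state M * K.-tuple (option (sym M) * move) :=
  if halting q then (q, [tuple (tnth h i, Stay) | i < K]) else trans q h.

(** The window includes the control cell because it determines the moves of all tapes; given the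
    moves, each stack shifts by at most one depth. *)
Definition next_cell (c0 cl c cr : cellT) : cellT :=
  if c0 is Some (inl qh) then
    let: (q, w) := action qh.1 qh.2 in
    match c with
    | Some (inl _) => Some (inl (q, [tuple match (tnth w i).2 with
        | Stay => (tnth w i).1
        | MoveLeft => left_sym cr i None
        | MoveRight => right_sym cr i None end | i < K]))
    | Some (inr lr) => Some (inr (
        [tuple match (tnth w i).2 with
         | Stay => tnth lr.1 i
         | MoveLeft => left_sym cr i None
         | MoveRight => left_sym cl i (tnth w i).1 end | i < K],
        [tuple match (tnth w i).2 with
         | Stay => tnth lr.2 i
         | MoveLeft => right_sym cl i (tnth w i).1
         | MoveRight => right_sym cr i None end | i < K]))
    | None => None
    end
  else c.

Definition cell W (c : config M) p : cellT :=
  if p is p'.+1 then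
    if p' < W then Some (inr ([tuple nth None (left (tnth (ctapes c) i)) p' | i < K],
                              [tuple nth None (right (tnth (ctapes c) i)) p' | i < K]))
    else None
  else Some (inl (cstate c, [tuple here (tnth (ctapes c) i) | i < K])).

Definition fits W (c : config M) := forall i,
  size (left (tnth (ctapes c) i)) <= W /\ size (right (tnth (ctapes c) i)) <= W.

Lemma stepE (c : config M) :
  let qw := action (cstate c) [tuple here (tnth (ctapes c) i) | i < K] in
  step c = Config qw.1 [tuple write_move (tnth qw.2 i) (tnth (ctapes c) i) | i < K].
Proof.
rewrite /step /action; case: halting => /=; last by case: trans.
case: c => q ts /=; congr Config; apply: eq_from_tnth => i.
by rewrite !tnth_mktuple write_here.
Qed.

Lemma fits_step W c : fits W c -> fits W.+1 (step c).
Proof.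
move=> h i; rewrite stepE /= tnth_mktuple.
case: (tnth (action _ _).2 i) => a m; have [hl hr] := h i.
by case: m => /=; rewrite ?size_behead; lia.
Qed.

(** The neighbours must be right only where they exist: the control cell has none on the left, and
    the end marker never changes. By [fits], the symbols beyond the last depth are blank. *)
Lemma cell_step W c p cl cr : fits W c -> 0 < W -> p <= W.+1 ->
  (0 < p -> cl = cell W c p.-1) -> (p <= W -> cr = cell W c p.+1) ->
  cell W (step c) p = next_cell (cell W c 0) cl (cell W c p) cr.
Proof.
move=> h W0 lep ecl ecr; rewrite stepE /next_cell /=.
case: action => q w /=; case: p lep ecl ecr => [|p] lep ecl ecr /=.
  rewrite ecr //= W0; congr (Some (inl (_, _))); apply: eq_from_tnth => i.
  rewrite !tnth_mktuple; case: (tnth w i) => a [] //=; rewrite ?tnth_mktuple ?nth0 //.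
case: ltnP => ltp //.
have {}ecl := ecl isT; have {}ecr := ecr ltp; rewrite /= in ecl.
have lsym i : left_sym cr i None = nth None (left (tnth (ctapes c) i)) p.+1.
  rewrite ecr /=; case: ltnP => [_|leW] /=; first by rewrite tnth_mktuple.
  by rewrite nth_default //; case: (h i) => hl _; apply: leq_trans hl _.
have rsym i : right_sym cr i None = nth None (right (tnth (ctapes c) i)) p.+1.
  rewrite ecr /=; case: ltnP => [_|leW] /=; first by rewrite tnth_mktuple.
  by rewrite nth_default //; case: (h i) => _ hr; apply: leq_trans hr _.
have lsym' i a : left_sym cl i a = nth None (a :: left (tnth (ctapes c) i)) p.
  by rewrite ecl; case: (p) ltp => [|p'] ltp //=; rewrite (ltnW ltp) /= tnth_mktuple.
have rsym' i a : right_sym cl i a = nth None (a :: right (tnth (ctapes c) i)) p.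
  by rewrite ecl; case: (p) ltp => [|p'] ltp //=; rewrite (ltnW ltp) /= tnth_mktuple.
congr (Some (inr (_, _))); apply: eq_from_tnth => i; rewrite !tnth_mktuple;
  case: (tnth w i) => a [] /=; rewrite ?lsym ?rsym ?lsym' ?rsym' ?nth_behead //.
Qed.

Definition on_tape0 (s : option (sym M)) : symbols := [tuple if i == ord0 then s else None | i < K].

Definition input_cell (s : option (sym M)) : cellT := Some (inr (on_tape0 None, on_tape0 s)).

Lemma input_cell_inj : injective input_cell.
Proof.
by move=> s s' /(congr1 (fun c => right_sym c ord0 None)) /=; rewrite !tnth_mktuple.
Qed.

Definition bit_sym (b : bool) : sym M := in_sym M (Some (inr b)).

Definition allowed (l : colL (option (A + bool))) : {set cellT} :=
  match l with
  | inl (true, o) => [set Some (inl (start M, on_tape0 (Some (in_sym M o))))]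
  | inl (false, o) => [set input_cell (Some (in_sym M o))]
  | inr None => [set input_cell None; input_cell (Some (bit_sym true)); input_cell (Some (bit_sym
    false))]
  | inr (Some true) => [set input_cell None]
  | inr (Some false) => [set None]
  end.

Definition accept_control : {set cellT} :=
  [set c | if c is Some (inl qh) then halting qh.1 && (tnth qh.2 ord_max == Some (out_sym M true))
           else false].
Definition accept_stack : {set cellT} :=
  [set c | if c is Some (inr lr) then tnth lr.2 ord_max == None else false].

(** The transition function in conjunctive form: each inconsistent window is excluded by requiring
    that one of the five cells differ from it. *)
Definition step_clauses : seq (clause cellT) :=
  [seq Clause [set~ c.1.1.1.1] [set~ c.1.1.1.2] [set~ c.1.1.2] [set~ c.1.2] [set~ c.2]
    | c <- enum {: cellT * cellT * cellT * cellT * cellT}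
    & c.2 != next_cell c.1.1.1.1 c.1.1.1.2 c.1.1.2 c.1.2].

(** The second clause propagates blanks to the right through the guessed cells, so that what is
    guessed is a word followed by blanks. *)
Definition init_clauses (l : colL (option (A + bool))) : seq (clause cellT) :=
  Clause set0 set0 (allowed l) set0 set0 ::
  (if l == LGuess then [:: Clause set0 set0 [set~ input_cell None] [set input_cell None] set0]
   else [::]).

Definition final_clauses (l : colL (option (A + bool))) : seq (clause cellT) :=
  if l is inl (true, _) then
    [:: Clause set0 set0 accept_control set0 set0; Clause set0 set0 set0 accept_stack set0]
  else [::].

(** The leading clause holds in every tableau; as a set to be hit it is the whole block of a cell
    and forces an element to be chosen there. *)
Definition clauses (r : rowL) (l : colL (option (A + bool))) : seq (clause cellT) :=
  Clause set0 set0 setT set0 set0 ::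
  (if r == LLast then final_clauses l else step_clauses) ++
  (if r == LFirst then init_clauses l else [::]).

Lemma clausesE f r l : all f (clauses r l) =
  [&& f (Clause set0 set0 setT set0 set0), all f (if r == LLast then final_clauses l else
    step_clauses)
    & all f (if r == LFirst then init_clauses l else [::])].
Proof. by rewrite /clauses /= all_cat. Qed.

Definition rows T : seq rowL := LFirst :: nseq T LMid ++ [:: LLast].

Definition input_prefix (x : seq A) : seq (option (A + bool)) := map (fun a => Some (inl a)) x ++
  [:: None].

Definition columns (x : seq A) P T : seq (colL (option (A + bool))) :=
  LCtrl (head None (input_prefix x)) :: map LFix (behead (input_prefix x)) ++
  nseq P LGuess ++ nseq T.+1 LBlank ++ [:: LEnd].

Definition accepting (c : config M) :=
  [/\ halting (cstate c), here (tnth (ctapes c) ord_max) = Some (out_sym M true) &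
      head None (right (tnth (ctapes c) ord_max)) = None].

Definition solution (a : nat -> nat -> cellT) x P T := forall t p,
  t < size (rows T) -> p < size (columns x P T) ->
  all (sat_clause a (size (rows T)) (size (columns x P T)) t p)
    (clauses (nth LMid (rows T) t) (nth LEnd (columns x P T) p)).

Lemma size_rows T : size (rows T) = T.+2.
Proof. by rewrite /= size_cat size_nseq addn1. Qed.

Lemma nth_rows T t : t < T.+2 -> nth LMid (rows T) t =
  if t == 0 then LFirst else if t == T.+1 then LLast else LMid.
Proof.
case: t => [|t] //; rewrite ltnS => le /=; rewrite nth_cat size_nseq eqSS.
case: ltngtP => [lt|gt|->]; last by rewrite subnn.
  by rewrite nth_nseq lt.
by lia.
Qed.

Section Run.
Variables (x : seq A) (P T : nat).
(** Depth needed: at the start at most [size x + P] symbols lie to the right of the head, and each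
    of the [T.+1] steps adds at most one to a side. *)
Let W := size x + P + T.+1.

Lemma size_columns : size (columns x P T) = W.+2.
Proof.
rewrite /columns -cat1s !(size_cat, size_map, size_behead, size_nseq).
by rewrite /W; cbn [size]; lia.
Qed.

Lemma nth_columns p : p < W.+2 -> nth LEnd (columns x P T) p =
  if p == 0 then LCtrl (head None (input_prefix x))
  else if p <= size x then LFix (nth None (input_prefix x) p)
  else if p <= size x + P then LGuess else if p <= W then LBlank else LEnd.
Proof.
case: p => [|p] //; rewrite ltnS => le; rewrite -[p.+1 == 0]/false -[LHS]/(nth LEnd
  (map LFix (behead (input_prefix x)) ++ nseq P LGuess ++ nseq T.+1 LBlank ++ [:: LEnd]) p).
have sz : size (behead (input_prefix x)) = size x.
  by rewrite size_behead /input_prefix size_cat size_map addn1.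
rewrite nth_cat size_map sz; case: ltnP => [lt|ge].
  by rewrite (nth_map None) ?sz // nth_behead.
rewrite nth_cat size_nseq nth_nseq ltn_subLR //; case: ltnP => [//|ge2].
rewrite nth_cat size_nseq nth_nseq.
case: (ltnP (p - size x - P)) => ge3.
  by have -> : p < W by rewrite /W; lia.
have -> : p < W = false by rewrite /W; lia.
by case: (_ - T.+1) => [|[]].
Qed.

Definition run u t := iter t (@step _ _ M) (init M (with_certificate x u)).

Lemma fits_run u t : size u <= P -> t <= T.+1 -> fits W (run u t).
Proof.
move=> su leT.
suff H : fits (size x + P + t) (run u t).
  by move=> i; have [h1 h2] := H i; split; [apply: leq_trans h1 _|apply: leq_trans h2 _]; rewrite
    /W; lia.
elim: t {leT} => [|t IH] i; last by rewrite addnS; apply: fits_step IH i.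
rewrite /run /= tnth_mktuple; case: eqP => _ //=.
have: size (map (in_sym M) (with_certificate x u)) <= (size x + P).+1.
  by rewrite size_map /with_certificate size_cat /= !size_map addnS ltnS leq_add2l.
by case: map => //= s w; rewrite size_map addn0.
Qed.

Lemma with_certificateE u : with_certificate x u = input_prefix x ++ map (fun b => Some (inr b)) u.
Proof. by rewrite /with_certificate /input_prefix -catA. Qed.

Lemma cell_init u p : size u <= P -> p < W.+2 -> cell W (run u 0) p =
  if p == 0 then Some (inl (start M, on_tape0 (Some (in_sym M (head None (input_prefix x))))))
  else if p <= W then
    input_cell (nth None (map (fun o => Some (in_sym M o)) (with_certificate x u)) p)
  else None.
Proof.
move=> su ltp; rewrite /cell /run /=.
have: with_certificate x u = head None (input_prefix x) :: behead (with_certificate x u).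
  by rewrite with_certificateE /input_prefix; case: (x).
case: with_certificate => // o z [->].
case: p ltp => [|p] ltp /=.
  congr (Some (inl (_, _))); apply: eq_from_tnth => i; rewrite !tnth_mktuple.
  by case: eqP.
case: ltnP => // _; congr (Some (inr (_, _))); apply: eq_from_tnth => i; rewrite !tnth_mktuple.
  by case: eqP => _; rewrite /= nth_nil ?if_same.
by case: eqP => _ /=; rewrite ?nth_nil // -map_comp.
Qed.

Lemma nth_input u p : nth None (map (fun o => Some (in_sym M o)) (with_certificate x u)) p =
  if p <= size x then Some (in_sym M (nth None (input_prefix x) p))
  else nth None (map (fun b => Some (bit_sym b)) u) (p - (size x).+1).
Proof.
have sz : size (input_prefix x) = (size x).+1 by rewrite /input_prefix size_cat size_map addn1.
rewrite with_certificateE map_cat nth_cat size_map sz ltnS.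
case: leqP => [le|gt]; first by rewrite (nth_map None) ?sz.
by rewrite -map_comp.
Qed.

Lemma rowE t : t < T.+2 ->
  ((nth LMid (rows T) t == LLast) = (t == T.+1)) * ((nth LMid (rows T) t == LFirst) = (t == 0)).
Proof.
move=> lt; rewrite nth_rows //.
by case: (t =P 0) => [->//|_]; case: (t =P T.+1).
Qed.

Arguments cell : simpl never.

Lemma solution_of_run u : size u <= P -> accepting (run u T.+1) ->
  solution (fun t => cell W (run u t)) x P T.
Proof.
move=> su [acc1 acc2 acc3] t p; rewrite size_rows size_columns => ltt ltp.
rewrite clausesE !rowE //; apply/and3P; split.
- by rewrite /sat_clause !inE !orbT.
- case: eqP => [->|ne].
    rewrite nth_columns //; case: eqP => [->|_]; last by (case: ifP => _ //; case: ifP => _ //;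
      case: ifP).
    rewrite /= /sat_clause !inE /cell /= acc1 tnth_mktuple acc2 eqxx /=.
    by rewrite /W addnS /= tnth_mktuple nth0 acc3.
  have ltT : t < T.+1 by lia.
  (* A violated clause would be an actual window of the run, and such windows are consistent by
     [cell_step]. *)
  rewrite all_map all_filter; apply/allP => c _ /=; apply/implyP; apply: contraR.
  rewrite /sat_clause /= !inE !negb_or !negb_and !negbK => /and5P[/eqP c0 cl /eqP cc cr].
  rewrite ltnS ltT /= => /eqP <-; apply/eqP; rewrite -c0 -cc; apply: cell_step.
  + by apply: fits_run => //; lia.
  + by rewrite /W addnS.
  + by [].
  + by move=> p0; move: cl; rewrite p0 => /eqP.
  + by move=> leW; move: cr; rewrite !ltnS leW => /eqP.
- case: eqP => [->|//]; rewrite nth_columns //; apply/andP; split.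
    rewrite /sat_clause /= !in_set0 !andbF !orbF /= cell_init //; case: eqP => [_|p0] /=; first
      by rewrite inE eqxx.
    rewrite nth_input; case: (leqP p (size x)) => [le|gt] /=.
      have -> : p <= W by rewrite /W; lia.
      by rewrite inE eqxx.
    case: (leqP p (size x + P)) => [le|gt2] /=.
      have -> : p <= W by rewrite /W; lia.
      case: (ltnP (p - (size x).+1) (size u)) => h; last by rewrite nth_default ?size_map // !inE
        eqxx.
      by rewrite (nth_map false) // !inE; case: (nth _ _ _); rewrite eqxx ?orbT.
    case: (leqP p W) => le /=; last by rewrite inE.
    by rewrite inE nth_default // size_map; lia.
  case: eqP => //= eG.
  have : (size x < p) && (p <= size x + P).
    move: eG; rewrite /LCtrl /LFix /LGuess /LBlank /LEnd; case: (p == 0) => //.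
    by case: leqP => // _; case: leqP => // _; case: (p <= W).
  move=> /andP[gt le]; rewrite /sat_clause !inE /= orbF andbF orFb.
  rewrite (cell_init su ltp) !nth_input.
  have -> : (p == 0) = false by case: (p) gt.
  have lpW : p < W by rewrite /W; lia.
  rewrite (ltnW lpW) leqNgt gt /= !ltnS (ltnW lpW) /= cell_init ?ltnS ?(ltnW lpW) //= lpW andbT
    nth_input ltnNge (ltnW gt) /=.
  case: (ltnP (p - (size x).+1) (size u)) => h.
    apply/orP; left; apply/eqP => /input_cell_inj.
    by rewrite (nth_map false).
  apply/orP; right; rewrite nth_default // size_map; lia.
Qed.
Lemma run_of_solution a : solution a x P T ->
  exists2 u, size u <= P & accepting (run u T.+1).
Proof.
move=> sol.
have {}sol t p : t < T.+2 -> p < W.+2 -> all (sat_clause a T.+2 W.+2 t p)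
    (clauses (nth LMid (rows T) t) (nth LEnd (columns x P T) p)).
  by have := sol t p; rewrite size_rows size_columns.
have row0 p : p < W.+2 -> a 0 p \in allowed (nth LEnd (columns x P T) p).
  move=> ltp; have := sol 0 p isT ltp; rewrite clausesE !rowE // => /and3P[_ _].
  by case/andP; rewrite /sat_clause /= !in_set0 !andbF !orbF.
pose dec (c : cellT) := if c is Some (inr lr) then
    if tnth lr.2 ord0 == Some (bit_sym true) then Some true
    else if tnth lr.2 ord0 == Some (bit_sym false) then Some false else None
  else None.
have bit_inj b b' : bit_sym b = bit_sym b' -> b = b' by move/in_sym_inj => -[].
have decK s : dec (input_cell (omap bit_sym s)) = s.
  rewrite /dec /= tnth_mktuple /=; case: s => [[]|] //=; rewrite ?eqxx //.
  by case: eqP => // -[/bit_inj].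
(* The certificate is read off the guessed cells; [x #] occupies columns 0 to [size x], so they
   start at [(size x).+1]. *)
pose g := mkseq (fun j => dec (a 0 ((size x).+1 + j))) P.
have gE j : j < P -> a 0 ((size x).+1 + j) = input_cell (omap bit_sym (nth None g j)).
  move=> lt; rewrite nth_mkseq //.
  have ltp : (size x).+1 + j < W.+2 by rewrite /W; lia.
  have := row0 _ ltp; rewrite nth_columns //.
  have -> : ((size x).+1 + j == 0) = false by [].
  have -> : ((size x).+1 + j <= size x) = false by lia.
  have -> : ((size x).+1 + j <= size x + P) by lia.
  rewrite !inE -orbA => /or3P[] /eqP ->.
  - by rewrite -{1 2}[None]/(omap bit_sym None) decK.
  - by rewrite -[Some (bit_sym true)]/(omap bit_sym (Some true)) decK.
  - by rewrite -[Some (bit_sym false)]/(omap bit_sym (Some false)) decK.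
have gchain j : nth None g j = None -> nth None g j.+1 = None.
  move=> gj; case: (ltnP j.+1 P) => lt; last by rewrite nth_default // size_mkseq.
  have ltp : (size x).+1 + j < W.+2 by rewrite /W; lia.
  have := sol 0 ((size x).+1 + j) isT ltp; rewrite clausesE !rowE // => /and3P[_ _].
  rewrite /init_clauses nth_columns //.
  have -> : ((size x).+1 + j == 0) = false by [].
  have -> : ((size x).+1 + j <= size x) = false by lia.
  have -> : ((size x).+1 + j <= size x + P) by lia.
  rewrite eqxx /= => /and3P[_]; rewrite /sat_clause /= !in_set0 ?andbF ?orbF !inE /=.
  rewrite (gE j) ?(ltnW lt) // gj eqxx /= => /andP[_] h _.
  move: h; rewrite -addnS gE // => /eqP /input_cell_inj.
  by case: (nth None g j.+1).
pose u := nonblank_prefix g.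
have gu j : nth None g j = nth None (map Some u) j by exact: nonblank_prefix_chain.
have su : size u <= P.
  have -> : P = size g by rewrite size_mkseq.
  by rewrite /u; elim: (g) => [|[b|] s IH].
exists u => //.
have rowt t : t < T.+2 -> forall p, p < W.+2 -> a t p = cell W (run u t) p.
  elim: t => [|t IH] ltt p ltp.
    have := row0 p ltp; rewrite nth_columns // cell_init // nth_input.
    case: eqP => [_|p0] /=; first by rewrite inE => /eqP.
    case: (leqP p (size x)) => [le|gt] /=.
      have -> : p <= W by rewrite /W; lia.
      by rewrite inE => /eqP.
    case: (leqP p (size x + P)) => [le _|gt2] /=.
      have -> : p <= W by rewrite /W; lia.
      have := gE (p - (size x).+1); rewrite subnKC // => -> //; last by lia.
      rewrite gu; congr input_cell.
      case: (ltnP (p - (size x).+1) (size u)) => h; last by rewrite !nth_default ?size_map.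
      by rewrite !(nth_map false).
    case: (leqP p W) => le /=; last by rewrite inE => /eqP.
    by rewrite inE => /eqP ->; rewrite nth_default // size_map; lia.
  have ltt' : t < T.+1 by [].
  have {}IH := IH (ltnW ltt).
  have W0 : 0 < W by rewrite /W addnS.
  have fit : fits W (run u t) by apply: fits_run; rewrite // ltnW.
  (* Otherwise the clause of this very window would be violated. At the borders [p.-1] and [p.+1]
     need not be neighbours; any content may be taken there, as missing cells do not count. *)
  have -> : a t.+1 p = next_cell (a t 0) (a t p.-1) (a t p) (a t p.+1).
    apply/eqP; apply: contraT => ne.
    have := sol t p (ltnW ltt) ltp; rewrite clausesE !rowE ?(ltnW ltt) //.
    rewrite (ltn_eqF ltt') => /and3P[_ + _].
    rewrite all_map all_filter => /allP /(_ (a t 0, a t p.-1, a t p, a t p.+1, a t.+1 p)).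
    rewrite mem_enum => /(_ isT) /implyP /(_ ne).
    by rewrite /sat_clause /= !inE !eqxx !andbF.
  rewrite /run iterS -/(run u t) IH // (IH p) //; symmetry; apply: cell_step => //.
    by move=> p0; rewrite IH //; lia.
  by move=> leW; rewrite IH.
have last_row : nth LMid (rows T) T.+1 = LLast by rewrite nth_rows // eqxx.
have ltT : T.+1 < T.+2 by [].
have := sol T.+1 0 ltT isT; rewrite clausesE last_row nth_columns // eqxx /= => /and3P[_ + _].
rewrite /sat_clause /= !in_set0 ?andbF ?orbF /= => /and3P[h1 h2 _]; move: h1 h2.
rewrite (rowt _ ltT 0) // (rowt _ ltT 1) //.
rewrite /cell !inE /= tnth_mktuple => /andP[h1 /eqP h2].
by rewrite /W addnS /= tnth_mktuple nth0 => /eqP h3.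
Qed.

End Run.
End Tableau.

(** * From tableaux to hitting sets *)

(** [Some None] marks the current position, [Some (Some true)] and
    [Some (Some false)] its left and right neighbours. *)
Definition markT : finType := option (option bool).

Definition rel_mark i j : markT :=
  if j == i then Some None else if j.+1 == i then Some (Some true)
  else if j == i.+1 then Some (Some false) else None.

Lemma rel_mark_cur i j : (rel_mark i j == Some None) = (j == i).
Proof. by rewrite /rel_mark; case: (j == i) => //; case: ifP => // _; case: ifP. Qed.

Definition mark_head (L : Type) (m : markT) (s : seq L) : seq (L * markT) :=
  if s is c :: s' then (c, m) :: [seq (c, None) | c <- s'] else [::].

(** Since the prefix [d] is stored in reverse, both neighbours of the current letter are heads of
    lists, and marking them needs no positions. *)
Definition marks (L : Type) (d : seq L) (a : L) (r : seq L) : seq (L * markT) :=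
  rev (mark_head (Some (Some true)) d) ++ (a, Some None) :: mark_head (Some (Some false)) r.

Lemma size_mark_head (L : Type) m (s : seq L) : size (mark_head m s) = size s.
Proof. by case: s => //= c s; rewrite size_map. Qed.

Lemma nth_mark_head (L : Type) (x0 : L) m s i : i < size s ->
  nth (x0, None) (mark_head m s) i = (nth x0 s i, if i == 0 then m else None).
Proof. by case: s i => [|c s] [|i] //= lt; rewrite (nth_map x0). Qed.

Lemma marksE (L : Type) (x0 : L) d a r : marks d a r =
  [seq (nth x0 (rev d ++ a :: r) j, rel_mark (size d) j) | j <- iota 0 (size (rev d ++ a :: r))].
Proof.
have sz : size (marks d a r) = size (rev d ++ a :: r).
  by rewrite !size_cat /= !size_rev !size_mark_head.
apply: (@eq_from_nth _ (x0, None)) => [|i]; first by rewrite size_map size_iota.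
rewrite sz => lt; rewrite (nth_map 0) ?size_iota // nth_iota // add0n.
rewrite /marks !nth_cat !size_rev size_mark_head /rel_mark.
case: (ltnP i (size d)) => lti.
  rewrite !nth_rev ?size_mark_head // nth_mark_head; last by lia.
  have -> : (size d - i.+1 == 0) = (i.+1 == size d) by lia.
  by rewrite (ltn_eqF lti); case: eqP => // _; rewrite (ltn_eqF (ltnW _)).
case e: (i - size d) => [|k] /=.
  by have -> : i == size d by lia.
have -> : (i == size d) = false by lia.
have -> : (i.+1 == size d) = false by lia.
rewrite nth_mark_head; last by move: lt; rewrite size_cat size_rev /=; lia.
by have -> : (i == (size d).+1) = (k == 0) by lia.
Qed.

Lemma all_zcat (L M : Type) (x0 : L) (f : pred M) (h : L -> seq L -> seq L -> seq M) s :
  all f (zcat h [::] s) <->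
  forall t, t < size s -> all f (h (nth x0 s t) (rev (take t s)) (drop t.+1 s)).
Proof.
suff H d r : all f (zcat h d r) <->
    forall t, t < size r -> all f (h (nth x0 r t) (catrev (take t r) d) (drop t.+1 r)).
  exact: H.
elim: r d => [|a r IH] d /=; first by split.
rewrite all_cat; split=> [/andP[h0 /IH hr] [|t] //= lt|H]; first by rewrite drop0.
  exact: hr.
apply/andP; split; first by have := H 0 isT; rewrite /= drop0.
by apply/IH => t lt; apply: (H t.+1).
Qed.

Lemma flatten_map_zcat (L M M' : Type) (phi : M -> seq M') (h : L -> seq L -> seq L -> seq M) d s :
  flatten (map phi (zcat h d s)) = zcat (fun a d r => flatten (map phi (h a d r))) d s.
Proof. by elim: s d => //= a s IH d; rewrite map_cat flatten_cat IH. Qed.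

Lemma eq_zcat (L M : Type) (h h' : L -> seq L -> seq L -> seq M) d s :
  (forall a d r, h a d r = h' a d r) -> zcat h d s = zcat h' d s.
Proof. by move=> e; elim: s d => //= a s IH d; rewrite e IH. Qed.

Lemma hits_flatten (I : Type) (F F' : I -> seq bool) (s : seq I) :
  (forall i, size (F i) = size (F' i)) ->
  hits (flatten (map F s)) (flatten (map F' s)) = has (fun i => hits (F i) (F' i)) s.
Proof. by move=> sz; elim: s => //= i s IH; rewrite /hits zip_cat // has_cat -IH. Qed.

Lemma hits_map (I : Type) (F F' : I -> bool) (s : seq I) :
  hits (map F s) (map F' s) = has (fun i => F i && ~~ F' i) s.
Proof. by elim: s => //= i s IH; rewrite -IH. Qed.

Lemma size_flatten_map (I M : Type) (F : I -> seq M) (s : seq I) c :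
  (forall i, size (F i) = c) -> size (flatten (map F s)) = size s * c.
Proof. by move=> sz; elim: s => //= i s IH; rewrite size_cat sz IH. Qed.

Lemma unflatten (M : Type) m c (u : seq M) : size u = m * c ->
  u = flatten [seq take c (drop (i * c) u) | i <- iota 0 m].
Proof.
elim: m u => [|m IH] u su; first by move/size0nil: su.
rewrite /= mul0n drop0 -{1}(cat_take_drop c u) {1}(IH (drop c u)); last by rewrite size_drop su
  mulSn addKn.
rewrite -[1]addn0 iotaDl -map_comp; congr (_ ++ flatten _); apply: eq_map => i /=.
by rewrite drop_drop mulnDl mul1n addnC.
Qed.

Lemma seq_of_enum (G : finType) (u : seq bool) : size u = #|G| ->
  u = [seq nth false u (enum_rank g) | g <- enum G].
Proof.
move=> su; apply: (@eq_from_nth _ false) => [|i]; first by rewrite size_map -cardE.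
rewrite su => lt; rewrite (nth_map (enum_val (Ordinal lt))) -?cardE //.
by rewrite -[i in RHS]/(val (Ordinal lt)) -enum_val_nth enum_valK.
Qed.

Lemma sumn_map_const (I : Type) (s : seq I) c : sumn [seq c | _ <- s] = size s * c.
Proof. by elim: s => //= _ s ->. Qed.

(** There is no slack: an excess in one term would push the sum above the bound. This turns the
    bound [k] into exactly one element per block. *)
Lemma sumn_tight (I : eqType) (F : I -> nat) (s : seq I) c :
  (forall i, i \in s -> c <= F i) -> sumn (map F s) <= size s * c ->
  forall i, i \in s -> F i = c.
Proof.
have low (r : seq I) : (forall i, i \in r -> c <= F i) -> size r * c <= sumn (map F r).
  elim: r => //= i r IH H; rewrite mulSn leq_add ?H ?mem_head // IH // => j jr.
  by apply: H; rewrite inE jr orbT.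
elim: s => //= j s IH H le i.
have Hs i' : i' \in s -> c <= F i' by move=> h; apply: H; rewrite inE h orbT.
have := low s Hs; have := H j (mem_head _ _); rewrite inE => h1 h2.
case/predU1P => [->|]; first by move: le; rewrite mulSn; lia.
by apply: IH => //; move: le; rewrite mulSn; lia.
Qed.

Section Grid.
Variables (G Rl Cl : finType) (g0 : G) (r0 : Rl) (c0 : Cl).
Variables (is_first : pred Cl) (cls : Rl -> Cl -> seq (clause G)).
Hypothesis cls_block : forall f r c, all f (cls r c) -> f (Clause set0 set0 setT set0 set0).

(** The contents by which a cell satisfies the clause, found from the marks of its row and column.
    The union with [on_first] is there because the first column may coincide with the current one or
    a neighbour. For rows, the mark of a right neighbour stands for the next row. *)
Definition chunk (cl : clause G) (m m' : markT) (b : bool) : {set G} :=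
  match m with
  | Some None => (if b then on_first cl else set0) :|:
      match m' with
      | Some None => on_cur cl
      | Some (Some true) => on_left cl
      | Some (Some false) => on_right cl
      | None => set0
      end
  | Some (Some false) => if m' == Some None then on_next cl else set0
  | _ => set0
  end.

Lemma chunk_block m m' b g :
  (g \in chunk (Clause set0 set0 setT set0 set0) m m' b) = (m == Some None) && (m' == Some None).
Proof. by case: m => [[[]|]|]; case: m' => [[[]|]|]; case: b; rewrite /= ?inE. Qed.

(** The zeros are the pairs of cell and content that satisfy the clause, so hitting the vector is
    satisfying the clause. *)
Definition vec cl (tau : seq (Rl * markT)) (pi : seq (Cl * markT)) : seq bool :=
  flatten [seq flatten [seq [seq g \notin chunk cl a.2 b.2 (is_first b.1) | g <- enum G] | b <- pi]
    | a <- tau].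

Definition vecs (sT : seq Rl) (sW : seq Cl) : seq (seq bool) :=
  zcat (fun a d r => zcat (fun b d' r' =>
    [seq vec cl (marks d a r) (marks d' b r') | cl <- cls a b]) [::] sW) [::] sT.

Definition grid R C (U : nat -> nat -> G -> bool) : seq bool :=
  flatten [seq flatten [seq [seq U t p g | g <- enum G] | p <- iota 0 C] | t <- iota 0 R].

Lemma size_grid R C U : size (grid R C U) = R * (C * #|G|).
Proof.
rewrite /grid (@size_flatten_map _ _ _ _ (C * #|G|)) ?size_iota // => t.
by rewrite (@size_flatten_map _ _ _ _ #|G|) ?size_iota // => p; rewrite size_map -cardE.
Qed.

Lemma hits_grid R C U V : hits (grid R C U) (grid R C V) =
  has (fun t => has (fun p => has (fun g => U t p g && ~~ V t p g) (enum G)) (iota 0 C)) (iota 0 R).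
Proof.
rewrite /grid hits_flatten => [|t].
  apply: eq_has => t; rewrite hits_flatten => [|p]; last by rewrite !size_map.
  by apply: eq_has => p; rewrite hits_map.
by rewrite !(@size_flatten_map _ _ _ _ #|G|) // => p; rewrite size_map -cardE.
Qed.

Lemma gridP R C (u : seq bool) : size u = R * (C * #|G|) -> exists U, u = grid R C U.
Proof.
move=> su.
pose B t := take (C * #|G|) (drop (t * (C * #|G|)) u).
pose D t p := take #|G| (drop (p * #|G|) (B t)).
exists (fun t p g => nth false (D t p) (enum_rank g)).
rewrite {1}(unflatten su) /grid; congr flatten; apply/eq_in_map => t; rewrite mem_iota => /andP[_
  lt].
have sB : size (B t) = C * #|G|.
  by rewrite size_takel // size_drop su -mulnBl leq_pmull // subn_gt0.
rewrite -/(B t) {1}(unflatten sB); congr flatten; apply/eq_in_map => p; rewrite mem_iota =>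
  /andP[_ lp].
apply: seq_of_enum; rewrite size_takel // size_drop sB -mulnBl leq_pmull // subn_gt0.
exact: lp.
Qed.

Lemma eq_grid R C U V : (forall t p g, t < R -> p < C -> U t p g = V t p g) -> grid R C U = grid
  R C V.
Proof.
move=> e; congr flatten; apply/eq_in_map => t; rewrite mem_iota => /andP[_ lt].
congr flatten; apply/eq_in_map => p; rewrite mem_iota => /andP[_ lp].
by apply: eq_map => g; apply: e.
Qed.

Lemma count_grid R C U : count id (grid R C U) =
  sumn [seq sumn [seq #|U t p| | p <- iota 0 C] | t <- iota 0 R].
Proof.
rewrite count_flatten -map_comp; congr sumn; apply: eq_map => t /=.
rewrite count_flatten -map_comp; congr sumn; apply: eq_map => p /=.
by rewrite count_map cardE {2}/enum_mem size_filter -enumT; apply: eq_count.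
Qed.

(** Merges the five special positions into one search over the whole grid, the form in which vectors
    are hit. *)
Lemma sat_clauseE (a : nat -> nat -> G) R C t p cl : t < R -> p < C ->
  sat_clause a R C t p cl = has (fun t' => has (fun p' =>
    a t' p' \in chunk cl (rel_mark t t') (rel_mark p p') (p' == 0)) (iota 0 C)) (iota 0 R).
Proof.
move=> lt lp; have eS n : (n.+1 == n) = false by lia.
apply/idP/idP => [|/hasP[t']].
  have wit t' p' : t' < R -> p' < C ->
      a t' p' \in chunk cl (rel_mark t t') (rel_mark p p') (p' == 0) ->
      has (fun t' => has (fun p' =>
        a t' p' \in chunk cl (rel_mark t t') (rel_mark p p') (p' == 0)) (iota 0 C)) (iota 0 R).
    move=> lt' lp' h; apply/hasP; exists t'; rewrite ?mem_iota //.
    by apply/hasP; exists p'; rewrite ?mem_iota.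
  case/or4P => [h|/andP[p0 h]|h|/orP[/andP[lp' h]|/andP[lt' h]]].
  - by apply: (wit t 0) => //; [lia|rewrite /rel_mark eqxx /= inE h].
  - apply: (wit t p.-1) => //; first by lia.
    rewrite /rel_mark eqxx /= inE prednK // eqxx.
    have -> : (p.-1 == p) = false by lia.
    by rewrite h orbT.
  - by apply: (wit t p) => //; rewrite /rel_mark !eqxx /= inE h orbT.
  - by apply: (wit t p.+1) => //; rewrite /rel_mark !eqxx /= !eS gtn_eqF //= inE h orbT.
  - by apply: (wit t.+1 p) => //; rewrite /rel_mark !eqxx eS gtn_eqF.
rewrite mem_iota => /andP[_ lt'] /hasP[p']; rewrite mem_iota => /andP[_ lp'].
rewrite /sat_clause /chunk {1}/rel_mark; case: eqP => [->|_].
  rewrite inE => /orP[].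
    by case: eqP => [->->//|_]; rewrite inE.
  rewrite /rel_mark; case: eqP => [->->|_]; first by rewrite !orbT.
  case: eqP => [<- /= ->|_]; first by rewrite !orbT.
  case: eqP => [e|_]; last by rewrite inE.
  by move: lp'; rewrite e => -> ->; rewrite !orbT.
case: eqP => _; first by rewrite inE.
case: eqP => [e|_]; last by rewrite inE.
rewrite rel_mark_cur; case: (p' =P p) => [->|_]; last by rewrite inE.
by move: lt'; rewrite e => -> /= ->; rewrite !orbT.
Qed.

Section Letters.
Variables (sT : seq Rl) (sW : seq Cl).
Let R := size sT.
Let C := size sW.
Hypothesis firstE : forall p, p < C -> is_first (nth c0 sW p) = (p == 0).

Definition clause_grid cl t p t' p' g :=
  g \notin chunk cl (rel_mark t t') (rel_mark p p') (p' == 0).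

Lemma all_vecs f : all f (vecs sT sW) <-> forall t p, t < R -> p < C ->
  all (fun cl => f (grid R C (clause_grid cl t p))) (cls (nth r0 sT t) (nth c0 sW p)).
Proof.
have zip_s (L : Type) (l0 : L) s t : t < size s -> rev (rev (take t s)) ++ nth l0 s t :: drop
  t.+1 s = s.
  by move=> lt; rewrite revK -drop_nth // cat_take_drop.
have vecE cl t p : t < R -> p < C ->
   vec cl (marks (rev (take t sT)) (nth r0 sT t) (drop t.+1 sT))
     (marks (rev (take p sW)) (nth c0 sW p) (drop p.+1 sW)) = grid R C (clause_grid cl t p).
  move=> lt lp; rewrite (marksE r0) (marksE c0) !zip_s // !size_rev !size_takel ?(ltnW lt) ?(ltnW
    lp) //.
  rewrite /vec -map_comp; congr flatten; apply: eq_map => t' /=.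
  rewrite -map_comp; congr flatten; apply/eq_in_map => p' /=; rewrite mem_iota => /andP[_ lp'].
  by apply: eq_map => g; rewrite firstE.
rewrite (all_zcat r0); split=> [H t p lt lp|H t lt].
  have /(all_zcat c0)/(_ p lp) := H t lt; rewrite all_map.
  by apply: sub_all => cl /=; rewrite vecE.
apply/(all_zcat c0) => p lp; rewrite all_map; have := H t p lt lp.
by apply: sub_all => cl /=; rewrite vecE.
Qed.

Lemma hits_indicator (a : nat -> nat -> G) cl t p : t < R -> p < C ->
  hits (grid R C (fun t p g => g == a t p)) (grid R C (clause_grid cl t p)) =
  sat_clause a R C t p cl.
Proof.
move=> lt lp; rewrite hits_grid sat_clauseE //; apply: eq_has => t'; apply: eq_has => p'.
rewrite /clause_grid; apply/hasP/idP => [[g _ /andP[/eqP -> /negPn]]//|h].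
by exists (a t' p'); rewrite ?mem_enum // eqxx h.
Qed.

Lemma hitting_set_tableau :
  (exists u, [/\ size u = R * (C * #|G|), count id u <= R * C & all (hits u) (vecs sT sW)]) <->
  exists a, forall t p, t < R -> p < C ->
    all (sat_clause a R C t p) (cls (nth r0 sT t) (nth c0 sW p)).
Proof.
split=> [[u [su cu /all_vecs H]]|[a H]]; last first.
  exists (grid R C (fun t p g => g == a t p)); split; first exact: size_grid.
    rewrite count_grid.
    have e t : sumn [seq #|fun g => g == a t p| | p <- iota 0 C] = C.
      rewrite (eq_map (g := fun=> 1)) => [|p]; last by rewrite (@eq_card _ _ (pred1 (a t p)))
        ?card1.
      by rewrite sumn_map_const size_iota muln1.
    by rewrite (eq_map e) sumn_map_const size_iota.
  apply/all_vecs => t p lt lp; have := H t p lt lp; apply: sub_all => cl.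
  by rewrite hits_indicator.
have [U eU] := gridP su.
(* The clause supplied by [cls_block] is the full block of the cell, so [u] has an element there. *)
have U1 t p : t < R -> p < C -> 0 < #|U t p|.
  move=> lt lp; have := cls_block (H t p lt lp); rewrite eU hits_grid.
  case/hasP => t' _ /hasP[p' _ /hasP[g _ /andP[h]]].
  rewrite negbK chunk_block !rel_mark_cur => /andP[/eqP <- /eqP <-].
  by apply/card_gt0P; exists g.
(* [R * C] disjoint nonempty blocks share at most [R * C] elements; tightness is applied to the rows
   and then to the cells of one row. *)
have U1' t p : t < R -> p < C -> #|U t p| = 1.
  move=> lt lp.
  have row t' : t' < R -> C <= sumn [seq #|U t' p'| | p' <- iota 0 C].
    move=> lt'; rewrite -{1}(size_iota 0 C) -sum1_size sumnE big_map.
    by rewrite big_seq [X in _ <= X]big_seq leq_sum // => p'; rewrite mem_iota => /andP[_];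
      apply: U1.
  have rowE : sumn [seq #|U t p'| | p' <- iota 0 C] = C.
    apply: (@sumn_tight _ (fun t => sumn [seq #|U t p'| | p' <- iota 0 C]) (iota 0 R)).
    - by move=> i; rewrite mem_iota => /andP[_]; apply: row.
    - by rewrite -count_grid -eU size_iota.
    - by rewrite mem_iota.
  apply: (@sumn_tight _ (fun p => #|U t p|) (iota 0 C)).
  - by move=> i; rewrite mem_iota => /andP[_]; apply: U1.
  - by rewrite rowE size_iota muln1.
  - by rewrite mem_iota.
(* A choice from singletons; the default [g0] can matter only outside the grid. *)
pose a t p := odflt g0 [pick g | U t p g].
have {}eU : u = grid R C (fun t p g => g == a t p).
  rewrite eU; apply: eq_grid => t p g lt lp.
  have /eqP/card1P[x hx] := U1' t p lt lp.
  rewrite /a; case: pickP => [y|/(_ x)] /=.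
    by have := hx y; have := hx g; rewrite !inE /in_mem /= => -> -> /eqP ->.
  by have := hx x; rewrite !inE /in_mem /= eqxx => ->.
exists a => t p lt lp; have := H t p lt lp; apply: sub_all => cl.
by rewrite eU hits_indicator.
Qed.

Definition instance : seq (option bool) :=
  join (rev (iter (R * C) bits_inc [::])) (nseq (R * (C * #|G|)) true :: vecs sT sW).

Lemma ClosureThreshold_instance : 1 < R * C -> ~ ClosureThreshold instance <->
  exists a, forall t p, t < R -> p < C ->
    all (sat_clause a R C t p) (cls (nth r0 sT t) (nth c0 sW p)).
Proof.
move=> RC; rewrite -hitting_set_tableau ClosureThresholdP nonblank_prefix_join blocks_join revK /=.
rewrite size_nseq bits_val_iter_inc add0n.
have valid : valid_word instance.
  rewrite /valid_word nonblank_prefix_join blocks_join /= size_rev; apply/and4P; split.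
  - have := last_iter_inc (ltnW RC).
    by case: (lastP (iter _ _ _)) => //= s b; rewrite last_rcons rev_rcons.
  (* With at most one digit the value would be below 2, against [1 < R * C]. *)
  - rewrite ltnNge; apply/negP => le; have := bits_val_lt (iter (R * C) bits_inc [::]).
    rewrite bits_val_iter_inc add0n ltnNge (leq_trans _ RC) //.
    by rewrite -[2]/(2 ^ 1) leq_exp2l.
  - by rewrite (eq_all (a2 := pred1 true)) ?all_pred1_nseq; last by case.
  - apply/all_vecs => t p lt lp; rewrite (eq_all (a2 := predT)) ?all_predT // => cl /=.
    by rewrite size_nseq size_grid eqxx.
split=> [nC|[u [su cu hu]] [_ H]].
  apply: NNPP => nu; apply: nC; split=> // u su cu; apply/negP => hu; apply: nu.
  by exists u.
by have := H u su cu; rewrite hu.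
Qed.

End Letters.
End Grid.

(** * The reduction is polynomial *)

Section Generator.
Variable N : nat.
Notation str := (seq 'I_N.+1).

(** The list [l] belongs to the machine and not to the input, so the loop is unrolled. The clauses
    of a cell form such a list. *)
Lemma FP_flatten_const (X T : Type) (ps : seq (X -> str)) (M : finType) (l : seq T)
    (F : T -> X -> seq M) :
  #|M| <= N.+1 -> (forall c, FP ps (fun x => enc N (F c x))) ->
  FP ps (fun x => enc N (flatten [seq F c x | c <- l])).
Proof.
move=> leM HF; elim: l => [|c l IH] /=; first exact: FP_nil.
exact: FP_cat.
Qed.

Variables (G Rl Cl : finType).
Variables (is_first : pred Cl) (cls : Rl -> Cl -> seq (clause G)).
Hypotheses (N_ge : 6 <= N) (leR : #|{: Rl * markT}| <= N.+1) (leC : #|{: Cl * markT}| <= N.+1).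

Lemma FP_mark_head (X : Type) (ps : seq (X -> str)) (L : finType) m (f : X -> seq L) :
  #|{: L * markT}| <= N.+1 -> FP ps (fun x => enc N (f x)) ->
  FP ps (fun x => enc N (mark_head m (f x))).
Proof.
move=> leLM Hf; have leL : #|L| <= N.+1.
  by apply: leq_trans leLM; rewrite card_prod leq_pmulr // !card_option.
apply: FP_ext (FP_case (g := fun o x => if o is Some c then
  enc N ((c, m) :: [seq (c, None : markT) | c <- behead (f x)]) else [::]) leL Hf _) => [x|[c|]].
- by case: (f x).
- by apply: FP_cons; apply: FP_map => //; apply: FP_behead_enc.
- exact: FP_nil.
Qed.

Lemma FP_marks (X : Type) (ps : seq (X -> str)) (L : finType) (a : L) (d r : X -> seq L) :
  #|{: L * markT}| <= N.+1 ->
  FP ps (fun x => enc N (d x)) -> FP ps (fun x => enc N (r x)) ->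
  FP ps (fun x => enc N (marks (d x) a (r x))).
Proof.
move=> leLM Hd Hr; apply: FP_cat => //; first by apply: FP_rev => //; apply: FP_mark_head.
by apply: FP_cons; apply: FP_mark_head.
Qed.

(** The contents in [G] are enumerated by the program itself, so only labels with marks have to fit
    into the alphabet. *)
Lemma FP_vec (X : Type) (ps : seq (X -> str)) (cl : clause G) (tau : X -> seq (Rl * markT))
    (pi : X -> seq (Cl * markT)) :
  FP ps (fun x => enc N (tau x)) -> FP ps (fun x => enc N (pi x)) ->
  FP ps (fun x => enc N (vec is_first cl (tau x) (pi x))).
Proof.
move=> Ht Hp; apply: FP_flatten_map => //; first by cardle.
move=> a; apply: (FP_flatten_map (phi := fun b _ =>
  [seq g \notin chunk cl a.2 b.2 (is_first b.1) | g <- enum G])) => //; first by cardle.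
by move=> b; apply: FP_const.
Qed.

Lemma FP_instance (X : Type) (ps : seq (X -> str)) (sT : X -> seq Rl) (sW : X -> seq Cl) :
  FP ps (fun x => enc N (sT x)) -> FP ps (fun x => enc N (sW x)) ->
  FP ps (fun x => enc N (instance is_first cls (sT x) (sW x))).
Proof.
move=> HT HW.
have leR' : #|Rl| <= N.+1 by apply: leq_trans leR; rewrite card_prod leq_pmulr // !card_option.
have leC' : #|Cl| <= N.+1 by apply: leq_trans leC; rewrite card_prod leq_pmulr // !card_option.
have Hn : FP ps (fun x => enc N (nseq (size (sT x) * size (sW x)) tt)).
  by apply: FP_nseqM; apply: FP_size.
rewrite /instance /join /=; apply: FP_cat; first by cardle.
  apply: FP_map; [by cardle|by cardle|]; apply: FP_rev; first by cardle.
  apply: FP_ext (FP_iter_inc N_ge (L := unit) predT _ Hn (FP_const _ [::])) => [x|]; last by cardle.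
  by rewrite count_predT size_nseq.
apply: FP_cons; apply: FP_cat; first by cardle.
  apply: FP_map; [by cardle|by cardle|]; apply: FP_nseq_const; first by cardle.
  apply: FP_nseqM; first exact: FP_size.
  apply: FP_nseqM; first exact: FP_size.
  exact: (FP_const _ (nseq #|G| tt)).
pose h a b d r d' r' := flatten
  [seq None :: map Some (vec is_first cl (marks d a r) (marks d' b r')) | cl <- cls a b].
apply: (@FP_ext _ _ _ (fun x => enc N
  (zcat (fun a d r => zcat (fun b d' r' => h a b d r d' r') [::] (sW x)) [::] (sT x)))) => [x|].
  rewrite /vecs flatten_map_zcat; congr enc; apply: eq_zcat => a d r.
  rewrite flatten_map_zcat; apply: eq_zcat => b d' r'.
  by rewrite -map_comp.
apply: (FP_zcat (h := fun a x d r => zcat (fun b d' r' => h a b d r d' r') [::] (sW x))) => //.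
  by cardle.
move=> a.
apply: (FP_zcat (f := fun y => sW y.1) (h := fun b y d' r' => h a b y.2.1 y.2.2 d' r')) => //.
- by cardle.
- exact: (FP_weak _ HW).
move=> b; apply: FP_flatten_const; first by cardle.
move=> cl; apply: FP_cons; apply: FP_map; [by cardle|by cardle|].
(* The inner fold is bound last: strings 0 and 1 are the prefix and the rest of the columns, 2 and 3
   those of the rows. *)
apply: FP_vec; apply: FP_marks => //.
- exact: (@FP_var _ _ _ 2).
- exact: (@FP_var _ _ _ 3).
- exact: (@FP_var _ _ _ 0).
- exact: (@FP_var _ _ _ 1).
Qed.

End Generator.

Lemma FP_rows N (X : Type) (ps : seq (X -> seq 'I_N.+1)) (n : X -> nat) : 2 <= N ->
  FP ps (fun x => enc N (nseq (n x) tt)) -> FP ps (fun x => enc N (rows (n x))).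
Proof.
move=> N2 Hn; have c : #|rowL| <= N.+1 by rewrite card_option card_bool.
apply: FP_cons; apply: FP_cat => //; last exact: FP_const.
exact: FP_nseq_const.
Qed.

Lemma FP_columns N (A : finType) (X : Type) (ps : seq (X -> seq 'I_N.+1)) (f : X -> seq A)
    (P T : X -> nat) :
  #|colL (option (A + bool))| <= N.+1 -> FP ps (fun x => enc N (f x)) ->
  FP ps (fun x => enc N (nseq (P x) tt)) -> FP ps (fun x => enc N (nseq (T x) tt)) ->
  FP ps (fun x => enc N (columns (f x) (P x) (T x))).
Proof.
move=> leC Hf HP HT.
have leO : #|{: option (A + bool)}| <= N.+1.
  by apply: leq_trans leC; rewrite [X in _ <= X]card_sum [X in _ <= X + _]card_prod card_bool
    mul2n -addnn -addnA leq_addr.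
have leA : #|A| <= N.+1.
  by apply: leq_trans leO; rewrite card_option card_sum; lia.
have Hrest : FP ps (fun x => enc N (map LFix (behead (input_prefix (f x))) ++
    nseq (P x) LGuess ++ nseq (T x).+1 LBlank ++ [:: LEnd])).
  apply: FP_cat => //.
    apply: FP_map => //; apply: FP_behead_enc; apply: FP_cat => //; last exact: FP_const.
    exact: FP_map.
  apply: FP_cat => //; first exact: FP_nseq_const.
  apply: FP_cat => //; last exact: FP_const.
  by apply: FP_cons; apply: FP_nseq_const.
(* The control column carries the first letter of [x #], which is the separator itself when [x] is
   empty; [omap inl] covers both cases. *)
apply: FP_ext (FP_case (g := fun o x => enc N (LCtrl (omap inl o : option (A + bool)) ::
  map LFix (behead (input_prefix (f x))) ++
  nseq (P x) LGuess ++ nseq (T x).+1 LBlank ++ [:: LEnd])) leA Hf _) => [x|o].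
  by rewrite /columns; case: (f x).
exact: FP_cons.
Qed.

(** * Hardness *)

Lemma accepting_output (A : finType) (M : machine (option (A + bool)) bool) z (b : bool) T T' :
  outputs_within M T z [:: b] -> T <= T' ->
  accepting (iter T' (@step _ _ M) (init M z)) <-> b.
Proof.
case=> h r le; rewrite -(subnK le) iterD.
set c := iter T _ _ in h r *.
have -> n : iter n (@step _ _ M) c = c by elim: n => //= n ->; rewrite /step h.
move: r; rewrite /read /accepting /=.
case: (here _) => [s|//] /= [es er]; split=> [[_ e _]|hb].
  by move: es; case: e => -> /out_sym_inj.
split=> //; first by rewrite es hb.
by case: (right _) er => //= -[].
Qed.

Lemma ClosureThreshold_coNP_hard : coNP_hard ClosureThreshold.
Proof.
move=> A L [V [p [[b [bV [M [q Mq]]]] H]]].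
pose P (x : seq A) := peval p (size x).
(* The running time on the longest relevant input: [x], the separator and a certificate of length
   [P x]. Monotonicity covers the shorter ones. *)
pose T (x : seq A) := peval q (size x + (P x).+1).
pose is_first (l : colL (option (A + bool))) := if l is inl (true, _) then true else false.
pose f x := instance is_first (@clauses A M) (rows (T x)) (columns x (P x) (T x)).
exists f; split.
  (* Room for the input alphabet and the marked labels of rows and columns; six more cover the fixed
     small alphabets. *)
  pose N := #|A| + #|{: rowL * markT}| + #|{: colL (option (A + bool)) * markT}| + 6.
  have leR : #|{: rowL * markT}| <= N.+1 by rewrite /N; lia.
  have leC : #|{: colL (option (A + bool)) * markT}| <= N.+1 by rewrite /N; lia.
  have leC' : #|colL (option (A + bool))| <= N.+1.
    by apply: leq_trans leC; rewrite [X in _ <= X]card_prod leq_pmulr // !card_option.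
  have N6 : 6 <= N by rewrite /N; lia.
  have leA : #|A| <= N.+1 by rewrite /N; lia.
  apply: (@FP_poly_time N) => //; first by rewrite card_option card_bool; lia.
  have Hx : FP [:: @enc N A] (fun x => enc N x) by exact: (@FP_var _ _ _ 0).
  have HP : FP [:: @enc N A] (fun x => enc N (nseq (P x) tt)).
    by apply: FP_nseq_peval; apply: FP_size.
  have HT : FP [:: @enc N A] (fun x => enc N (nseq (T x) tt)).
    apply: FP_nseq_peval; apply: FP_ext (FP_cat (L := unit) _ (FP_size leA Hx) (FP_cons tt HP))
      => [x|].
      by rewrite nseqD.
    by rewrite card_unit.
  apply: FP_instance => //; first by apply: FP_rows => //; lia.
  exact: FP_columns.
move=> x.
have acc u : size u <= P x -> accepting (run M x u (T x).+1) <-> V (with_certificate x u).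
  move=> su; rewrite bV; apply: accepting_output (Mq _) _.
  apply: leq_trans (leqnSn _); apply: peval_mono.
  by rewrite /with_certificate size_cat /= !size_map leq_add2l ltnS.
have first_col c : c < size (columns x (P x) (T x)) ->
    is_first (nth LEnd (columns x (P x) (T x)) c) = (c == 0).
  rewrite size_columns => lt; rewrite nth_columns //; case: eqP => //= _.
  by do 3 (case: ifP => // _).
have blk (g : pred (clause (cellT M))) r c : all g (clauses M r c) -> g (Clause set0 set0 setT
  set0 set0).
  by rewrite clausesE => /andP[].
have RC : 1 < size (rows (T x)) * size (columns x (P x) (T x)).
  by rewrite size_rows size_columns; lia.
have key : ~ ClosureThreshold (f x) <-> ~ L x.
  rewrite (ClosureThreshold_instance None LMid blk first_col RC) -[~ L x]/(complement L x) (H x);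
    split=> [[a sol]|[u [su hu]]].
    have [u su hu] := run_of_solution (sol : solution a x (P x) (T x)).
    by exists u; split=> //; apply/acc.
  by exists (fun t => cell (size x + P x + (T x).+1) (run M x u t)); apply: solution_of_run =>
    //; apply/acc.
(* The equivalence is obtained for the complements; classical logic removes the negations. *)
by split=> h; apply: NNPP; [rewrite key|rewrite -[~ L x]key] => n; apply: n.
Qed.

Theorem theorem27 : coNP_complete ClosureThreshold.
Proof. by split; [exact: ClosureThreshold_in_coNP|exact: ClosureThreshold_coNP_hard]. Qed.
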